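(* Let $d\in\mathbb{N}$ and $\lambda>0$. The gnomonic projection $\Pi_{\mathrm{gn}}(V^{\mathrm{typ}}_{d,\lambda})$ of the typical cell of the stationary hyperbolic Poisson-Voronoi tessellation with intensity $\lambda$ on $\mathbb{H}^d$ has the same distribution as the convex dual $P_{d,\alpha,d}^\circ$ of the beta$^*$ polytope $P_{d,\alpha,d}$ with $$\alpha=\frac{2^d\lambda}{\tilde c_{d,d}}=\frac{2^d\pi^{d/2}\lambda\,\Gamma(d/2)}{\Gamma(d)}.$$
   Context: Hyperboloid model: $\mathbb{H}^d=\{(x_0,\dots,x_d)\in\mathbb{R}^{d+1}:x_0^2-x_1^2-\dots-x_d^2=1,\ x_0>0\}$ with geodesic distance $d_{\mathrm{hyp}}(x,y)=\operatorname{arcosh}(x_0y_0-x_1y_1-\dots-x_dy_d)$ and the corresponding Riemannian volume measure $\nu_{\mathrm{hyp}}$ (curvature $-1$); $e=(1,0,\dots,0)$. The gnomonic projection is $\Pi_{\mathrm{gn}}:\mathbb{H}^d\to\mathbb{B}^d$, $\Pi_{\mathrm{gn}}(x)=(x_1/x_0,\dots,x_d/x_0)$, where $\mathbb{B}^d$ is the open unit ball in $\mathbb{R}^d$ with closure $\overline{\mathbb{B}}^d$. Let $\eta_{d,\lambda}$ be a Poisson process on $\mathbb{H}^d$ with intensity measure $\lambda\,\nu_{\mathrm{hyp}}$. The typical cell is $$V^{\mathrm{typ}}_{d,\lambda}=\{y\in\mathbb{H}^d:d_{\mathrm{hyp}}(y,e)\le d_{\mathrm{hyp}}(y,z)\text{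 for all }z\in\eta_{d,\lambda}\}.$$ For $\alpha>0$, $\beta>d/2$, $P_{d,\alpha,\beta}$ is the closed convex hull of the atoms of a Poisson process on $\mathbb{R}^d\setminus\overline{\mathbb{B}}^d$ with Lebesgue intensity $\alpha\,\tilde c_{d,\beta}(\|x\|^2-1)^{-\beta}$, where $\tilde c_{d,\beta}=\frac{\Gamma(\beta)}{\pi^{d/2}\Gamma(\beta-\frac d2)}$. The convex dual of $K\subset\mathbb{R}^d$ is $K^\circ=\{x\in\mathbb{R}^d:\langle x,y\rangle\le1\text{ for all }y\in K\}$. Equality in distribution is understood for random closed convex sets. *)

(* Defs.v *)
From HB Require Import structures.
From mathcomp Require Import all_boot all_order all_algebra.
From mathcomp Require Import all_classical all_reals all_analysis.
From mathcomp Require Import measurable_realfun.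

Set Implicit Arguments.
Unset Strict Implicit.
Unset Printing Implicit Defensive.

Import Order.TTheory GRing.Theory Num.Theory.
Import numFieldNormedType.Exports.

Local Open Scope classical_set_scope.
Local Open Scope ring_scope.

(* The sigma-algebra on R^n generated by the coordinates, i.e. the Borel
   sigma-algebra. *)
Section rV_measurable.
Context {R : realType} (n : nat).

Let coord (i : 'I_n) (x : 'rV[R]_n) : R := x ord0 i.

Let rV_set0 : g_sigma_preimage coord set0.
Proof. exact: sigma_algebra0. Qed.

Let rV_setC A : g_sigma_preimage coord A -> g_sigma_preimage coord (~` A).
Proof. exact: sigma_algebraC. Qed.

Let rV_bigcup (F : (set 'rV[R]_n)^nat) :
  (forall i, g_sigma_preimage coord (F i)) ->
  g_sigma_preimage coord (\bigcup_i (F i)).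
Proof. exact: sigma_algebra_bigcup. Qed.

HB.instance Definition _ := @isMeasurable.Build default_measure_display
  'rV[R]_n (g_sigma_preimage coord) rV_set0 rV_setC rV_bigcup.

End rV_measurable.

Lemma measurable_coord_rV {R : realType} n (i : 'I_n) :
  measurable_fun setT (fun x : 'rV[R]_n => x ord0 i).
Proof.
move=> _ Y mY; rewrite setTI; apply: sub_sigma_algebra => /=.
rewrite -bigcup_seq/=; exists i => /=; first by rewrite mem_index_enum.
by exists Y => //; rewrite setTI.
Qed.

Lemma measurable_fun_rVP {R : realType} d (T : measurableType d) n
    (f : T -> 'rV[R]_n) :
  (forall i, measurable_fun setT (fun x => f x ord0 i)) ->
  measurable_fun setT f.
Proof.
move=> mf.
apply: (@measurability _ _ _ _ setT f
  (\big[setU/set0]_(i < n) preimage_set_system setT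
     (fun x : 'rV[R]_n => x ord0 i) measurable)) => //.
move=> _ [B + <-]; rewrite -bigcup_seq/= => -[i _ [C mC <-]].
by rewrite setTI; have := mf i measurableT C mC; rewrite !setTI; exact.
Qed.

Definition rV_cons {R : realType} n (p : measurableTypeR R * 'rV[R]_n) :
    'rV[R]_n.+1 :=
  row_mx (const_mx p.1 : 'rV_1) p.2.

Section rV_cons_theory.
Context {R : realType} (n : nat).
Implicit Type p : measurableTypeR R * 'rV[R]_n.

Lemma rV_consE0 p : rV_cons p ord0 ord0 = p.1.
Proof.
rewrite /rV_cons (_ : ord0 = lshift n (ord0 : 'I_1)); last exact/val_inj.
by rewrite (row_mxEl (const_mx p.1 : 'rV_1) p.2 ord0 ord0) mxE.
Qed.

Lemma rV_consES p i : rV_cons p ord0 (lift ord0 i) = p.2 ord0 i.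
Proof.
rewrite /rV_cons (_ : lift ord0 i = rshift 1 i); last exact/val_inj.
exact: (row_mxEr (const_mx p.1 : 'rV_1) p.2 ord0 i).
Qed.

Lemma measurable_rV_cons : measurable_fun setT (@rV_cons R n).
Proof.
apply: measurable_fun_rVP => i; have [j ->|->] := unliftP ord0 i.
  under eq_fun do rewrite rV_consES.
  exact: (measurableT_comp (measurable_coord_rV j) measurable_snd).
under eq_fun do rewrite rV_consE0.
exact: measurable_fst.
Qed.

Lemma rV_cons_surj (x : 'rV[R]_n.+1) :
  x = rV_cons (x ord0 ord0, \row_i x ord0 (lift ord0 i)).
Proof.
apply/rowP => i; have [j ->|->] := unliftP ord0 i.
  by rewrite rV_consES mxE.
by rewrite rV_consE0.
Qed.

End rV_cons_theory.

Section lebesgue_rV.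
Context {R : realType}.

Section step.
Context (n : nat) (mu : {sigma_finite_measure set 'rV[R]_n -> \bar R}).

Let mcons : measurable_fun setT (@rV_cons R n) := @measurable_rV_cons R n.

Definition lebesgue_rV_step : set 'rV[R]_n.+1 -> \bar R :=
  pushforward (lebesgue_measure \x mu)%E (@rV_cons R n).

Let step0 : lebesgue_rV_step set0 = 0%E.
Proof. by rewrite /lebesgue_rV_step /pushforward preimage_set0 measure0. Qed.

Let step_ge0 A : (0 <= lebesgue_rV_step A)%E.
Proof. exact: measure_ge0. Qed.

Let step_sigma_additive : semi_sigma_additive lebesgue_rV_step.
Proof.
move=> F mF tF mUF; rewrite /lebesgue_rV_step /pushforward preimage_bigcup.
apply: measure_semi_sigma_additive.
- by move=> k; rewrite -[X in measurable X]setTI; exact: mcons.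
- apply/trivIsetP => /= i j _ _ ij; rewrite -preimage_setI.
  by move/trivIsetP : tF => /(_ _ _ _ _ ij) ->//; rewrite preimage_set0.
- by rewrite -preimage_bigcup -[X in measurable X]setTI; exact: mcons.
Qed.

HB.instance Definition _ := isMeasure.Build _ _ _ lebesgue_rV_step
  step0 step_ge0 step_sigma_additive.

Let step_sigma_finite : sigma_finite setT lebesgue_rV_step.
Proof.
have [F FT mF] : sigma_finite setT (lebesgue_measure \x mu)%E.
  have /sigma_finiteP[F [TF ndF Foo]] := sigma_finiteT (@lebesgue_measure R).
  have /sigma_finiteP[G [TG ndG Goo]] := sigma_finiteT mu.
  exists (fun k => F k `*` G k).
    rewrite -setXTT TF TG predeqE => -[x y]; split.
      move=> [/= [i _ Fx] [j _ Gy]]; exists (maxn i j) => //; split.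
      - by move: x Fx; exact/subsetPset/ndF/leq_maxl.
      - by move: y Gy; exact/subsetPset/ndG/leq_maxr.
    by move=> [k _ []/= ? ?]; split; exists k.
  move=> k; have [? ?] := Foo k; have [? ?] := Goo k.
  split; first exact: measurableX.
  by rewrite product_measure1E// lte_mul_pinfty// ge0_fin_numE.
pose u (x : 'rV[R]_n.+1) : measurableTypeR R * 'rV[R]_n :=
  (x ord0 ord0, \row_i x ord0 (lift ord0 i)).
have mu_ : measurable_fun setT u.
  apply: measurable_fun_pair => /=; first exact: measurable_coord_rV.
  apply: measurable_fun_rVP => i; under eq_fun do rewrite mxE.
  exact: measurable_coord_rV.
have uK p : u (rV_cons p) = p.
  rewrite /u rV_consE0; case: p => a v /=; congr pair.
  by apply/rowP => i; rewrite mxE rV_consES.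
exists (fun k => u @^-1` F k); first by rewrite -preimage_bigcup -FT.
move=> k; have [mFk Fk] := mF k; split.
  by rewrite -[X in measurable X]setTI; exact: mu_.
rewrite /lebesgue_rV_step /pushforward.
by rewrite [X in (_ X < _)%E](_ : _ = F k)//; apply/seteqP; split=> p /=;
  rewrite uK.
Qed.

HB.instance Definition _ := Measure_isSigmaFinite.Build _ _ _
  lebesgue_rV_step step_sigma_finite.

End step.

(* n-fold product of the one-dimensional Lebesgue measure *)
Fixpoint lebesgue_rV (n : nat) : {sigma_finite_measure set 'rV[R]_n -> \bar R} :=
  if n is m.+1 then lebesgue_rV_step (lebesgue_rV m) else \d_(0 : 'rV[R]_0).

End lebesgue_rV.
Arguments lebesgue_rV {R} n.

Lemma lebesgue_rV_box {R : realType} n (A : 'I_n -> set (measurableTypeR R)) :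
  (forall i, measurable (A i)) ->
  lebesgue_rV n [set x : 'rV[R]_n | forall i, A i (x ord0 i)] =
  (\prod_(i < n) lebesgue_measure (A i))%E.
Proof.
elim: n A => [|n IHn] A mA.
  by rewrite big_ord0 /= diracE mem_set// => -[].
set B := [set v : 'rV[R]_n | forall i, A (lift ord0 i) (v ord0 i)].
have mB : measurable B.
  rewrite (_ : B = \bigcap_(i in [set: 'I_n])
      ((fun v : 'rV[R]_n => v ord0 i) @^-1` A (lift ord0 i))); last first.
    by apply/seteqP; split=> [v Bv i _|v Bv i]; [exact: Bv|exact: (Bv i I)].
  apply: fin_bigcap_measurable => // i _.
  rewrite -[X in measurable X]setTI.
  exact: (measurable_coord_rV i measurableT (mA (lift ord0 i))).
rewrite big_ord_recl -IHn//= /lebesgue_rV_step /pushforward.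
rewrite -product_measure1E//; congr (_ _); apply/seteqP; split=> [p/= Ap|p/=].
  split; first by rewrite -rV_consE0; exact: Ap.
  by move=> i; rewrite -rV_consES; exact: Ap.
by move=> [Ap Bp] i; have [j ->|->] := unliftP ord0 i;
  rewrite ?rV_consES ?rV_consE0.
Qed.

Section euclidean.
Context {R : realType} (n : nat).
Implicit Types (x y : 'rV[R]_n) (K : set 'rV[R]_n).

Definition dotv x y : R := \sum_(i < n) x ord0 i * y ord0 i.

(* The library norm on 'rV[R]_n is the sup norm. *)
Definition enorm x : R := Num.sqrt (dotv x x).

Definition closed_convex_hull K : set 'rV[R]_n :=
  smallest (fun C : set 'rV[R]_n => closed C /\ convex_set C) K.

Definition convex_dual K : set 'rV[R]_n :=
  [set x | forall y, K y -> dotv x y <= 1].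

End euclidean.

Section hyperboloid.
Context {R : realType} (d : nat).
Implicit Types (x y z : 'rV[R]_d.+1) (v : 'rV[R]_d).

(* signature (+, -, ..., -) *)
Definition lorentz x y : R :=
  x ord0 ord0 * y ord0 ord0 -
  \sum_(i < d) x ord0 (lift ord0 i) * y ord0 (lift ord0 i).

Definition hyperboloid : set 'rV[R]_d.+1 :=
  [set x | lorentz x x = 1 /\ 0 < x ord0 ord0].

Definition arcosh (t : R) : R := ln (t + Num.sqrt (t ^+ 2 - 1)).

Definition hyp_dist x y : R := arcosh (lorentz x y).

Definition hyp_origin : 'rV[R]_d.+1 := delta_mx ord0 ord0.

Definition gnomonic x : 'rV[R]_d :=
  \row_(i < d) (x ord0 (lift ord0 i) / x ord0 ord0).

(* The global chart (x_1, ..., x_d) |-> (x_0, x_1, ..., x_d) of the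
   hyperboloid. *)
Definition hyp_chart v : 'rV[R]_d.+1 :=
  rV_cons (Num.sqrt (1 + dotv v v), v).

(* The Riemannian metric of the hyperboloid is the restriction of
   [- lorentz] to its tangent spaces. *)
Definition hyp_metric v : 'M[R]_d :=
  \matrix_(i < d, j < d)
    - lorentz ('D_(delta_mx ord0 i) hyp_chart v)
              ('D_(delta_mx ord0 j) hyp_chart v).

(* Riemannian volume, sqrt (det g) dx_1 ... dx_d in the chart, extended by 0
   outside the hyperboloid. *)
Definition hyp_volume (B : set 'rV[R]_d.+1) : \bar R :=
  (\int[lebesgue_rV d]_(v in hyp_chart @^-1` B)
     (Num.sqrt (\det (hyp_metric v)))%:E)%E.

(* The cell with nucleus [hyp_origin] among the nuclei Z. *)
Definition typical_cell (Z : set 'rV[R]_d.+1) : set 'rV[R]_d.+1 :=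
  [set y | hyperboloid y /\
           forall z, Z z -> hyp_dist y hyp_origin <= hyp_dist y z].

End hyperboloid.
Arguments hyperboloid {R} d.
Arguments gnomonic {R d} x.

Section poisson_process.
Context {R : realType} {dT dE} {T : measurableType dT} {E : measurableType dE}.
Implicit Types (X : set E) (mu : set E -> \bar R) (eta : R.-ker T ~> E).

(* eta w is a countable (finite or infinite) sum of Dirac masses at points
   of X. *)
Definition point_process X eta := forall w, exists (I : set nat) (x : nat -> E),
  (forall k, I k -> X (x k)) /\
  forall B, measurable B -> eta w B = (\esum_(k in I) \d_(x k) B)%E.

Definition atoms eta (w : T) : set E := [set x | eta w [set x] != 0%E].

(* [poisson_prob r _] is the Poisson distribution with parameter r (the Dirac
   mass at 0 when r = 0); it does not depend on its second argument. *)
Definition poisson_process (P : probability T R) X mu eta :=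
  [/\ point_process X eta,
      forall B, measurable B -> (mu B < +oo)%E ->
        forall k, P [set w | eta w B = k%:R%:E] =
                  poisson_prob (fine (mu B)) 0 [set k],
      forall B, measurable B -> mu B = +oo%E ->
        P [set w | eta w B = +oo%E] = 1%E &
      forall n (B : 'I_n -> set E),
        (forall i, measurable (B i)) -> trivIset setT B ->
        forall A : 'I_n -> set (\bar R), (forall i, measurable (A i)) ->
        P [set w | forall i, A i (eta w (B i))] =
        (\prod_(i < n) P [set w | A i (eta w (B i))])%E].

End poisson_process.

Section random_closed_set.
Context {R : realType} (n : nat).

(* Generated by the sets of those F that hit a given compact set; its trace on
   the closed sets is the Borel sigma-algebra of the Fell topology. *)
Definition fell_measurable : set (set (set 'rV[R]_n)) :=
  <<s [set H | exists2 K, compact K & H = [set F | F `&` K !=set0]] >>.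

Definition random_closed_convex_set dT (T : measurableType dT)
    (P : probability T R) (X : T -> set 'rV[R]_n) :=
  (forall H, fell_measurable H -> measurable (X @^-1` H)) /\
  {ae P, forall w, closed (X w) /\ convex_set (X w)}.

Definition same_distribution dT (T : measurableType dT) (P : probability T R)
    (X : T -> set 'rV[R]_n) dT' (T' : measurableType dT')
    (P' : probability T' R) (X' : T' -> set 'rV[R]_n) :=
  [/\ random_closed_convex_set P X, random_closed_convex_set P' X' &
      forall H, fell_measurable H -> P (X @^-1` H) = P' (X' @^-1` H)].

End random_closed_set.

Section beta_star.
Context {R : realType}.

Definition Gamma (x : R) : R :=
  \int[lebesgue_measure]_(t in `]0, +oo[) (t `^ (x - 1) * expR (- t)).

Definition ctilde (d : nat) (beta : R) : R :=
  Gamma beta / (pi `^ (d%:R / 2) * Gamma (beta - d%:R / 2)).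

Definition outside_ball (d : nat) : set 'rV[R]_d := [set x | 1 < enorm x].
Arguments outside_ball d : clear implicits.

Definition beta_star_intensity (d : nat) (alpha beta : R)
    (B : set 'rV[R]_d) : \bar R :=
  (\int[lebesgue_rV d]_(x in B `&` outside_ball d)
     (alpha * ctilde d beta * (enorm x ^+ 2 - 1) `^ (- beta))%:E)%E.

Definition beta_star_process dT (T : measurableType dT) (P : probability T R)
    (d : nat) (alpha beta : R) (zeta : R.-ker T ~> 'rV[R]_d) :=
  poisson_process P (outside_ball d) (beta_star_intensity alpha beta) zeta.

Definition beta_star_polytope dT (T : measurableType dT) (d : nat)
    (zeta : R.-ker T ~> 'rV[R]_d) (w : T) : set 'rV[R]_d :=
  closed_convex_hull (atoms zeta w).

End beta_star.
Arguments outside_ball {R} d.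

(* Main.v *)
(* Dividing the inequality [d(y, e) <= d(y, z)] by [y_0] shows that the gnomonic
   projection of the typical cell is the intersection of the open unit ball with
   the convex dual of the points [z' / (z_0 - 1)], where [z'] is the spatial part
   of a nucleus [z].  This map carries the hyperbolic volume to the beta-star
   intensity: both are radial, so averaging over dilations reduces the change of
   variables to the one-dimensional substitution [s = 2 t / (t^2 - 1)].  Void
   probabilities determine the law of the family of hitting events of a Poisson
   process, and the Fell sigma-algebra pulls back to that family under duality.
   Finally, the dual is almost surely contained in the open ball (so that the
   intersection with it is harmless, and the cell is closed): a union bound over
   about [k^d] directions, each of whose horoballs has mass at least [c k], shows
   that almost surely no horoball through the origin is empty. *)
Require Import Defs.
From HB Require Import structures.
From mathcomp Require Import all_boot all_order all_algebra.
From mathcomp Require Import all_classical all_reals all_analysis.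
From mathcomp Require Import measurable_realfun.
From mathcomp Require Import ring lra zify.

Set Implicit Arguments.
Unset Strict Implicit.
Unset Printing Implicit Defensive.

Import Order.TTheory GRing.Theory Num.Theory.
Import numFieldNormedType.Exports.

Local Open Scope classical_set_scope.
Local Open Scope ring_scope.

(** Missing [A] and missing [B] is missing their union, so miss events form a pi-system; this is why
    equal void probabilities give equal laws. The cell, however, is the dual cut by an open ball,
    and agrees with the dual only off an event that is not shown to be measurable. Measurability is
    therefore proved for the cut dual at every sample point, and the exceptional event is enclosed
    in events of arbitrarily small probability. A horoball has infinite volume, but it fills slowly:
    it is a paraboloid of radius about [sqrt (2 t)] at height [t], where the density is about
    [1 / t], so its part up to height [k ^ 2] has volume of order [k ^ (d - 1)]. For [d >= 2] this
    beats the logarithm of the number of directions; for [d = 1] it degenerates to a logarithm, but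
    there are only two directions. Hence two separate covers. The factor [2 ^ d] is produced by the
    radial substitution, one [2] for each power of [s] and one for its differential, while [ctilde]
    cancels; cancelling it requires finite and positive Gamma values. *)

Local Open Scope ereal_scope.

(** * Lebesgue integrals under dilations *)

Section scaling.
Context {R : realType}.
Notation mu := (@lebesgue_measure R).

(** By uniqueness of Lebesgue measure: [r] times its preimage measure under [x |-> r * x] gives each
    interval []a, b]] the mass [b - a]. *)
Lemma lebesgue_measure_scale (r : R) (A : set R) : (0 < r)%R ->
  measurable A -> mu [set x | A (r * x)%R] = r^-1%:E * mu A.
Proof.
move=> r0 mA.
have mr : measurable_fun setT (fun x : measurableTypeR R => (r * x)%R : measurableTypeR R).
  exact: measurable_funM.
pose m := mscale (NngNum (ltW r0)) (pushforward mu
  (fun x : measurableTypeR R => (r * x)%R : measurableTypeR R)).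
have -> : mu A = m mr A.
  apply: lebesgue_measure_unique => // _ [[a b]] _ <-.
  rewrite /m /= /mscale /= /pushforward.
  rewrite (_ : _ @^-1` _ = `](a / r)%R, (b / r)%R]%classic); last first.
    by apply/seteqP; split => x /=; rewrite !in_itv/= ltr_pdivrMr// ler_pdivlMr// mulrC.
  rewrite !lebesgue_measure_itv/= !lte_fin ltr_pM2r ?invr_gt0//.
  case: ifPn => // _; last by rewrite mule0.
  by rewrite -EFinB -EFinM -mulrBl mulrCA divff ?gt_eqF// mulr1.
by rewrite /m /mscale/= muleA -EFinM mulVf ?gt_eqF// mul1e.
Qed.

Lemma ge0_integral_scale (r : R) (f : R -> \bar R) : (0 < r)%R ->
  measurable_fun setT f -> (forall x, 0 <= f x) ->
  \int[mu]_x f (r * x)%R = r^-1%:E * \int[mu]_x f x.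
Proof.
move=> r0 mf f0.
pose phi := fun x : measurableTypeR R => (r * x)%R : measurableTypeR R.
have mr : measurable_fun setT phi by exact: measurable_funM.
rewrite -(@ge0_integral_pushforward _ _ _ _ R phi mr mu setT f)//.
have r1 : (0 <= r^-1)%R by rewrite invr_ge0 ltW.
have -> : r^-1%:E = (NngNum r1)%:num%:E by [].
rewrite -ge0_integral_mscale//.
apply: eq_measure_integral => A mA _ /=.
by rewrite /mscale/= -lebesgue_measure_scale.
Qed.

(** The Jacobian stays under the integral sign, so that after rescaling two integrals can be
    compared pointwise. *)
Lemma ge0_integral_rescale (r : R) (f : R -> \bar R) : (0 < r)%R ->
  measurable_fun setT f -> (forall x, 0 <= f x) ->
  \int[mu]_x f x = \int[mu]_x (r%:E * f (r * x)%R).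
Proof.
move=> r0 mf f0.
have mr : measurable_fun setT
    (fun x : measurableTypeR R => (r * x)%R : measurableTypeR R).
  exact: measurable_funM.
rewrite ge0_integralZl//; last 2 first.
- exact (measurableT_comp mf mr).
- by rewrite lee_fin ltW.
by rewrite ge0_integral_scale// muleA -EFinM divff ?gt_eqF// mul1e.
Qed.

Lemma ge0_integral_lebesgue_rVS n (f : 'rV[R]_n.+1 -> \bar R) :
  measurable_fun setT f -> (forall x, 0 <= f x) ->
  \int[lebesgue_rV n.+1]_x f x =
  \int[mu]_a \int[lebesgue_rV n]_v f (rV_cons (a, v)).
Proof.
move=> mf f0; rewrite /= /lebesgue_rV_step.
rewrite ge0_integral_pushforward//; last exact: measurable_rV_cons.
rewrite preimage_setT fubini_tonelli1//.
  by apply: measurableT_comp => //; exact: measurable_rV_cons.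
by move=> x; exact: f0.
Qed.

Lemma rV_consZ n (r : R) (p : measurableTypeR R * 'rV[R]_n) :
  (r *: rV_cons p)%R = rV_cons ((r * p.1)%R, (r *: p.2)%R).
Proof.
apply/rowP => i; rewrite mxE; have [j ->|->] := unliftP ord0 i.
  by rewrite !rV_consES mxE.
by rewrite !rV_consE0.
Qed.

Lemma measurable_scale_rV n (r : R) : measurable_fun setT (fun x : 'rV[R]_n => (r *: x)%R).
Proof.
apply: measurable_fun_rVP => i; under eq_fun do rewrite mxE.
by apply: measurable_funM => //; exact: measurable_coord_rV.
Qed.

(** Induction on the dimension: Tonelli splits off the first coordinate, and each coordinate
    contributes one factor [r^-1]. In dimension 0 the measure is the Dirac mass at the only
    vector. *)
Lemma ge0_integral_scale_rV n (r : R) (f : 'rV[R]_n -> \bar R) : (0 < r)%R ->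
  measurable_fun setT f -> (forall x, 0 <= f x) ->
  \int[lebesgue_rV n]_x f (r *: x)%R = (r ^- n)%:E * \int[lebesgue_rV n]_x f x.
Proof.
move=> r0; elim: n => [|n IH] in f *.
  move=> mf f0; rewrite expr0 invr1 mul1e /=.
  rewrite !integral_dirac//; first by rewrite scaler0.
  by apply: measurableT_comp => //; exact: measurable_scale_rV.
move=> mf f0.
rewrite !ge0_integral_lebesgue_rVS//; last first.
  by apply: measurableT_comp => //; exact: measurable_scale_rV.
under eq_integral do under eq_integral do rewrite rV_consZ/=.
have mfc : measurable_fun setT (f \o @rV_cons R n).
  by apply: measurableT_comp => //; exact: measurable_rV_cons.
under eq_integral => a _.
  rewrite (IH (fun v => f (rV_cons ((r * a)%R, v)))) //.
  2: by apply: (measurableT_comp mfc); exact: measurable_pair1.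
  over.
pose F := fun a : measurableTypeR R => \int[lebesgue_rV n]_v f (rV_cons (a, v)).
have mF : measurable_fun setT F.
  exact: (measurable_fun_fubini_tonelli_F _ mfc (fun x => f0 _)).
have F0 a : 0 <= F a by apply: integral_ge0 => x _.
have mFr : measurable_fun setT (fun a : measurableTypeR R => F (r * a)%R).
  have mr : measurable_fun setT
      (fun x : measurableTypeR R => (r * x)%R : measurableTypeR R).
    exact: measurable_funM.
  exact: (measurableT_comp mF mr).
have rn0 : 0 <= (r ^- n)%:E by rewrite lee_fin invr_ge0 exprn_ge0// ltW.
rewrite (@ge0_integralZl _ _ _ mu _ measurableT _ mFr _ (fun a _ => F0 _) rn0).
rewrite (@ge0_integral_scale r F)// muleA; congr (_ * _).
by rewrite -EFinM -invfM exprS mulrC.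
Qed.

Lemma ge0_integral_rescale_rV n (r : R) (f : 'rV[R]_n -> \bar R) : (0 < r)%R ->
  measurable_fun setT f -> (forall x, 0 <= f x) ->
  \int[lebesgue_rV n]_x f x = \int[lebesgue_rV n]_x ((r ^+ n)%:E * f (r *: x)%R).
Proof.
move=> r0 mf f0; rewrite ge0_integralZl//; last 2 first.
- exact: (measurableT_comp mf (measurable_scale_rV _)).
- by rewrite lee_fin exprn_ge0// ltW.
rewrite ge0_integral_scale_rV// muleA -EFinM divff ?mul1e//.
by rewrite expf_neq0// gt_eqF.
Qed.

End scaling.

Local Close Scope ereal_scope.

(** Inversion is not continuous at 0, so it is written on each half-line as a real power with
    exponent [-1], whose value at 0 is also 0. *)
Lemma measurable_invr {R : realType} :
  measurable_fun setT (@GRing.inv R).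
Proof.
rewrite (_ : GRing.inv = fun x : R =>
    if 0 <= x then x `^ (-1) else - ((- x) `^ (-1))); last first.
  apply/funext => x; case: ifPn => [x0|]; first by rewrite powR_inv1.
  by rewrite -ltNge => x0; rewrite powR_inv1 ?oppr_ge0 1?ltW// invrN opprK.
apply: measurable_fun_ifT => //=; first exact: measurable_fun_ler.
have mpN : measurable_fun setT (fun x : R => (- x) `^ (-1)).
  exact: (measurableT_comp (@measurable_powR R (-1))).
exact (@measurable_funN _ _ R setT _ mpN).
Qed.

Lemma measurable_fun_divr {R : realType} d (T : measurableType d) (f g : T -> R) :
  measurable_fun setT f -> measurable_fun setT g ->
  measurable_fun setT (fun x => f x / g x).
Proof.
move=> mf mg; apply: measurable_funM => //.
exact: (measurableT_comp measurable_invr).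
Qed.

Section euclidean_norm.
Context {R : realType} (n : nat).
Implicit Types x y : 'rV[R]_n.

Lemma dotvC x y : dotv x y = dotv y x.
Proof. by apply: eq_bigr => i _; rewrite mulrC. Qed.

Lemma dotvDl x y z : dotv (x + y) z = dotv x z + dotv y z.
Proof. by rewrite -big_split; apply: eq_bigr => i _; rewrite mxE mulrDl. Qed.

Lemma dotvZl r x y : dotv (r *: x) y = r * dotv x y.
Proof. by rewrite /dotv big_distrr; apply: eq_bigr => i _; rewrite mxE/= mulrA. Qed.

Lemma dotvDr x y z : dotv z (x + y) = dotv z x + dotv z y.
Proof. by rewrite dotvC dotvDl !(dotvC z). Qed.

Lemma dotvZr r x y : dotv x (r *: y) = r * dotv x y.
Proof. by rewrite dotvC dotvZl dotvC. Qed.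

Lemma dotv_ge0 x : 0 <= dotv x x.
Proof. by apply: sumr_ge0 => i _; rewrite -expr2 sqr_ge0. Qed.

Lemma dotvv_eq0 x : (dotv x x == 0) = (x == 0).
Proof.
apply/eqP/eqP => [|->]; last by rewrite /dotv big1// => i _; rewrite mxE mul0r.
move/psumr_eq0P => h; apply/rowP => i; rewrite mxE; apply/eqP.
by rewrite -sqrf_eq0 expr2 h// => j _; rewrite -expr2 sqr_ge0.
Qed.

Lemma enorm_ge0 x : 0 <= enorm x.
Proof. exact: sqrtr_ge0. Qed.

Lemma sqr_enorm x : enorm x ^+ 2 = dotv x x.
Proof. by rewrite sqr_sqrtr// dotv_ge0. Qed.

Lemma enorm_eq0 x : (enorm x == 0) = (x == 0).
Proof. by rewrite -sqrf_eq0 sqr_enorm dotvv_eq0. Qed.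

Lemma enorm_gt0 x : (0 < enorm x) = (x != 0).
Proof. by rewrite lt0r enorm_ge0 andbT enorm_eq0. Qed.

Lemma enorm0 : enorm (0 : 'rV[R]_n) = 0.
Proof. by apply/eqP; rewrite enorm_eq0. Qed.

Lemma enormZ r x : enorm (r *: x) = `|r| * enorm x.
Proof.
rewrite /enorm dotvZl dotvZr mulrA -expr2 sqrtrM ?sqr_ge0//.
by rewrite sqrtr_sqr.
Qed.

Lemma measurable_dotv d (T : measurableType d) (f g : T -> 'rV[R]_n) :
  measurable_fun setT f -> measurable_fun setT g ->
  measurable_fun setT (fun t => dotv (f t) (g t)).
Proof.
move=> mf mg; apply: measurable_sum => i; apply: measurable_funM.
  exact: (measurableT_comp (measurable_coord_rV i) mf).
exact: (measurableT_comp (measurable_coord_rV i) mg).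
Qed.

Lemma measurable_enorm : measurable_fun setT (@enorm R n).
Proof.
apply: (@measurableT_comp _ _ _ _ _ _ (@Num.sqrt R)).
  by apply: continuous_measurable_fun; exact: sqrt_continuous.
exact: measurable_dotv.
Qed.

End euclidean_norm.

Local Open Scope ereal_scope.

(** * Polar coordinates by averaging over dilations *)

Section polar.
Context {R : realType} (n : nat).
Notation mu := (@lebesgue_measure R).

Let w (t : R) : R := \1_(`[1%R, 2%R]%classic : set R) t.

Let w_ge0 t : (0 <= w t)%R. Proof. by rewrite /w indicE. Qed.

Let mw : measurable_fun setT (w : measurableTypeR R -> measurableTypeR R).
Proof. exact: measurable_indic. Qed.

(** The polar Jacobian in dimension [n.+1], cut to positive radii so that radial integrals can run
    over the whole line. *)
Definition pos_pow (s : R) : R := if (0 < s)%R then (s ^+ n)%R else 0%R.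

Lemma pos_pow_ge0 s : (0 <= pos_pow s)%R.
Proof. by rewrite /pos_pow; case: ifPn => // s0; rewrite exprn_ge0// ltW. Qed.

Lemma measurable_pos_pow : measurable_fun setT pos_pow.
Proof.
apply: measurable_fun_ifT => //=; first exact: measurable_fun_ltr.
Qed.

(* Polar coordinates without a measure on the sphere: the directions are
   sampled by the points [x] of the shell [1 <= |x| <= 2]. *)
Definition radial_average (F : 'rV[R]_n.+1 -> \bar R) : \bar R :=
  \int[lebesgue_rV n.+1]_x ((w (enorm x))%:E *
    \int[mu]_s ((pos_pow s)%:E * F ((s / enorm x) *: x)%R)).

(** The weight that dilation by [r] leaves at a point of norm [t] once the average has been
    rearranged. It is a function of [t / r] times the scale-invariant [dr / r], so its integral over
    [r] is the same for all [t > 0]. *)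
Let kap (r t : R) : R :=
  if (0 < r)%R then (r^-1 * (w (t / r) * (t / r) ^+ n.+1))%R else 0%R.

Let kap_ge0 r t : (0 <= t)%R -> (0 <= kap r t)%R.
Proof.
rewrite /kap => t0; case: ifPn => // r0.
by rewrite !mulr_ge0 ?invr_ge0 ?exprn_ge0 ?divr_ge0// ltW.
Qed.

Let mkap : measurable_fun setT (fun z : measurableTypeR R * measurableTypeR R => kap z.1 z.2).
Proof.
have mdiv : measurable_fun setT
    (fun z : measurableTypeR R * measurableTypeR R => z.2 / z.1 : R)%R.
  exact: measurable_fun_divr.
apply: measurable_fun_ifT => //=; first exact: measurable_fun_ltr.
apply: measurable_funM; first exact: (measurableT_comp measurable_invr).
apply: measurable_funM; first exact: (measurableT_comp mw).
exact: measurable_funX.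
Qed.

(** With [u = r^-1] this is the integral of [u ^ n] over [[1, 2]]. It appears on both sides of the
    comparison, so positivity and finiteness suffice to cancel it. *)
Definition radial_const : \bar R := \int[mu]_r (kap r 1)%:E.

Lemma radial_const_ge0 : 0 <= radial_const.
Proof. by apply: integral_ge0 => r _; rewrite lee_fin kap_ge0. Qed.

Let mkap1 : measurable_fun setT (fun r : measurableTypeR R => (kap r 1)%:E).
Proof.
apply/measurable_EFinP.
exact (measurableT_comp mkap (measurable_fun_pair
  (@measurable_id _ (measurableTypeR R) _) (measurable_cst ((1%R : R) : measurableTypeR R)))).
Qed.

Let kap1E r : kap r 1 = (\1_(`[2^-1%R, 1%R]%classic : set R) r * r^-1 ^+ n.+2)%R.
Proof.
rewrite /kap /w !indicE !mem_setE !in_itv/=; case: ifPn => r0; last first.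
  have rh : (r < 2^-1)%R by rewrite -leNgt in r0; rewrite (le_lt_trans r0)// invr_gt0.
  by rewrite lt_geF// mul0r.
rewrite !div1r invf_ge1// andbC.
rewrite [X in (X && _)%:R](_ : _ = (2^-1 <= r)%R); first by rewrite mulrCA -!exprS.
by rewrite -[in RHS](invrK r) lef_pV2 ?posrE ?invr_gt0.
Qed.

Let lebesgue_half_one : mu (`[2^-1%R, 1%R]%classic : set R) = (2^-1)%:E.
Proof.
rewrite lebesgue_measure_itv/= lte_fin invf_lt1// ltr1n -EFinB; congr EFin.
by lra.
Qed.

Lemma radial_const_gt0 : 0 < radial_const.
Proof.
rewrite (@lt_le_trans _ _ (2^-1)%:E)// ?lte_fin ?invr_gt0//.
rewrite -lebesgue_half_one -(setIT `[2^-1%R, 1%R]%classic) -integral_indic//.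
apply: ge0_le_integral => //=.
- by apply/measurable_EFinP; exact: measurable_indic.
- move=> r _; rewrite lee_fin kap1E indicE.
  case: (boolP (_ \in _)); last by rewrite mul0r.
  rewrite inE/= in_itv/= mul1r => /andP[r0 r1].
  have {}r0 : (0 < r)%R by rewrite (lt_le_trans _ r0)// invr_gt0.
  by rewrite exprn_ege1// invf_ge1.
Qed.

Lemma radial_const_fin : radial_const \is a fin_num.
Proof.
rewrite ge0_fin_numE ?radial_const_ge0//.
apply: (@le_lt_trans _ _ (\int[mu]_r ((2 ^+ n.+2)%:E *
    (\1_(`[2^-1%R, 1%R]%classic : set R) r)%:E))).
  apply: ge0_le_integral => //=.
  - by move=> r _; rewrite lee_fin kap_ge0.
  - by apply: emeasurable_funM => //; apply/measurable_EFinP; exact: measurable_indic.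
  move=> r _; rewrite -EFinM lee_fin kap1E indicE.
  case: (boolP (_ \in _)); last by rewrite mul0r mulr0.
  rewrite inE/= in_itv/= mul1r mulr1 => /andP[r0 r1].
  have r00 : (0 < r)%R by rewrite (lt_le_trans _ r0)// invr_gt0.
  rewrite ler_pXn2r// ?nnegrE ?invr_ge0 ?(ltW r00)//.
  by rewrite -[leRHS]invrK lef_pV2// posrE invr_gt0.
rewrite ge0_integralZl//; last first.
  by apply/measurable_EFinP; exact: measurable_indic.
rewrite integral_indic// setIT [X in _ * X]lebesgue_half_one.
by rewrite -EFinM ltry.
Qed.

Let int_kap t : (0 < t)%R -> \int[mu]_r (kap r t)%:E = radial_const.
Proof.
move=> t0; pose g r := (kap r t)%:E.
have mg : measurable_fun setT g.
  apply/measurable_EFinP.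
  exact (measurableT_comp mkap (measurable_fun_pair (@measurable_id _ (measurableTypeR R) _) (measurable_cst t))).
have g0 r : 0 <= g r by rewrite lee_fin kap_ge0// ltW.
rewrite -/(\int[mu]_r g r) (ge0_integral_rescale t0 mg g0).
apply: eq_integral => r _; rewrite /g -EFinM; congr EFin.
rewrite /kap pmulr_rgt0//; case: ifPn => r0; last by rewrite mulr0.
have -> : (t / (t * r) = 1 / r)%R by field; rewrite !gt_eqF.
by rewrite mulrA; congr (_ * _)%R; field; rewrite !gt_eqF.
Qed.

Let w_eq0 t : (t <= 0)%R -> w t = 0%R.
Proof.
move=> t0; rewrite /w indicE memNset//= in_itv/= => /andP[t1 _].
by have := le_trans t1 t0; rewrite ler10.
Qed.

(** Reduces an identity of integrals in space to one along each ray; the origin drops out because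
    the shell weight vanishes there. *)
Lemma eq_radial_average (F G : 'rV[R]_n.+1 -> \bar R) :
  (forall x, x != 0%R ->
    \int[mu]_s ((pos_pow s)%:E * F ((s / enorm x) *: x)%R) =
    \int[mu]_s ((pos_pow s)%:E * G ((s / enorm x) *: x)%R)) ->
  radial_average F = radial_average G.
Proof.
move=> FG; apply: eq_integral => x _; have [->|/FG->//] := eqVneq x 0%R.
by rewrite enorm0 w_eq0// !mul0e.
Qed.

(** Substituting [s = |x| r], exchanging the integrals and substituting [y = r x] leaves [kap r |y|]
    in front of [F y], and its integral over [r] is constant. At [y = 0] that weight vanishes, so
    the pointwise identity there rests on [F 0 = 0]. *)
Lemma radial_averageE (F : 'rV[R]_n.+1 -> \bar R) : measurable_fun setT F ->
  (forall x, 0 <= F x) -> F 0%R = 0 ->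
  radial_average F = radial_const * \int[lebesgue_rV n.+1]_x F x.
Proof.
move=> mF F0 F00.
pose H x r := (w (enorm x) * (enorm x ^+ n.+1 * pos_pow r))%:E * F (r *: x)%R.
have H0 x r : 0 <= H x r.
  rewrite /H mule_ge0// lee_fin mulr_ge0// mulr_ge0 ?pos_pow_ge0//.
  by rewrite exprn_ge0// enorm_ge0.
have mscale : measurable_fun setT
    (fun z : 'rV[R]_n.+1 * measurableTypeR R => (z.2 *: z.1)%R).
  apply: measurable_fun_rVP => i; under eq_fun do rewrite mxE.
  apply: measurable_funM => //.
  exact: (measurableT_comp (measurable_coord_rV i) measurable_fst).
have mnorm : measurable_fun setT
    (fun z : 'rV[R]_n.+1 * measurableTypeR R => enorm z.1 : measurableTypeR R).
  exact (measurableT_comp (@measurable_enorm R n.+1) measurable_fst).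
have mF1 : measurable_fun setT
    (fun z : 'rV[R]_n.+1 * measurableTypeR R => F z.1).
  exact (measurableT_comp mF measurable_fst).
have mH : measurable_fun setT
    (fun z : 'rV[R]_n.+1 * measurableTypeR R => H z.1 z.2).
  apply: emeasurable_funM; last exact (measurableT_comp mF mscale).
  apply/measurable_EFinP; apply: measurable_funM.
    exact (measurableT_comp mw mnorm).
  apply: measurable_funM; first exact: measurable_funX.
  exact (measurableT_comp measurable_pos_pow measurable_snd).
have mK : measurable_fun setT (fun z : 'rV[R]_n.+1 * measurableTypeR R =>
    (kap z.2 (enorm z.1))%:E * F z.1).
  apply: emeasurable_funM; last exact: mF1.
  apply/measurable_EFinP.
  exact (measurableT_comp mkap (measurable_fun_pair measurable_snd mnorm)).
(* Substitution [s = |x| r] in the inner integral, which makes the argument of [F] bilinear in [r]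
   and [x]. *)
transitivity (\int[lebesgue_rV n.+1]_x \int[mu]_r H x r).
  apply: eq_integral => x _.
  have [|x0] := leP (enorm x) 0%R.
    move=> /w_eq0 wx; rewrite wx mul0e integral0_eq// => r _.
    by rewrite /H wx mul0r mul0e.
  pose g s := (pos_pow s)%:E * F ((s / enorm x) *: x)%R.
  have mg : measurable_fun setT g.
    apply: emeasurable_funM.
      by apply/measurable_EFinP; exact: measurable_pos_pow.
    apply: (measurableT_comp mF); apply: measurable_fun_rVP => i.
    under eq_fun do rewrite mxE.
    by apply: measurable_funM => //; exact: measurable_fun_divr.
  have g0 s : 0 <= g s by rewrite mule_ge0// lee_fin pos_pow_ge0.
  have mt : measurable_fun setT (fun s : measurableTypeR R =>
      ((enorm x)%:E * g (enorm x * s)%R)).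
    apply: emeasurable_funM => //.
    have mt : measurable_fun setT
        (fun s : measurableTypeR R => (enorm x * s)%R : measurableTypeR R).
      exact: measurable_funM.
    exact (measurableT_comp mg mt).
  rewrite -/(\int[mu]_s g s) (ge0_integral_rescale x0 mg g0).
  rewrite -ge0_integralZl//; last 2 first.
  - by move=> s _; rewrite mule_ge0// lee_fin ltW.
  - by rewrite lee_fin.
  apply: eq_integral => r _; rewrite /g /H /pos_pow pmulr_rgt0//.
  rewrite mulrAC divff ?gt_eqF// mul1r !muleA -!EFinM; congr (_%:E * _).
  case: ifPn => r0; last by rewrite !mulr0.
  by rewrite exprMn exprS; ring.
rewrite (@fubini_tonelli _ _ _ _ R (lebesgue_rV n.+1) mu _ mH (fun z => H0 _ _)).
(* Now [r] is outermost; for fixed [r > 0], substitute [y = r x]. *)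
transitivity (\int[mu]_r \int[lebesgue_rV n.+1]_y ((kap r (enorm y))%:E * F y)).
  apply: eq_integral => r _.
  have [r0|r0] := leP r 0%R.
    rewrite !integral0_eq//= => x _; first by rewrite /kap ltNge r0 mul0e.
    by rewrite /H /pos_pow ltNge r0 mulr0 mulr0 mul0e.
  rewrite [RHS](ge0_integral_rescale_rV r0); last 2 first.
  - exact (measurableT_comp mK (measurable_pair2 r)).
  - by move=> y; rewrite mule_ge0// lee_fin kap_ge0// enorm_ge0.
  apply: eq_integral => x _; rewrite /H /kap /pos_pow r0 enormZ gtr0_norm//.
  rewrite muleA -EFinM; congr (_%:E * _).
  rewrite (_ : r * enorm x / r = enorm x)%R; last by field; rewrite gt_eqF.
  by rewrite (exprS r); field; rewrite gt_eqF.
have K0 (z : 'rV[R]_n.+1 * measurableTypeR R) :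
    0 <= (kap z.2 (enorm z.1))%:E * F z.1.
  by rewrite mule_ge0// lee_fin kap_ge0// enorm_ge0.
rewrite -(@fubini_tonelli _ _ _ _ R (lebesgue_rV n.+1) mu _ mK K0).
rewrite -ge0_integralZl//; last exact: radial_const_ge0.
apply: eq_integral => x _ /=.
have [->|x0] := eqVneq x 0%R.
  by rewrite F00 mule0 integral0_eq// => r _; rewrite /= mule0.
rewrite ge0_integralZr//; first by rewrite int_kap// enorm_gt0.
  apply/measurable_EFinP.
  exact (measurableT_comp mkap (measurable_fun_pair
    (@measurable_id _ (measurableTypeR R) _) (measurable_cst (enorm x)))).
by move=> r _; rewrite lee_fin kap_ge0// enorm_ge0.
Qed.

End polar.

Local Close Scope ereal_scope.

Local Open Scope ereal_scope.

Section density_measure.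
Context d (T : measurableType d) (R : realType) (mu : {measure set T -> \bar R}).
Variable f : T -> \bar R.
Hypotheses (mf : measurable_fun setT f) (f0 : forall x, 0 <= f x).

Definition density (A : set T) : \bar R := \int[mu]_(x in A) f x.

Let density0 : density set0 = 0. Proof. exact: integral_set0. Qed.
Let density_ge0 A : 0 <= density A.
Proof. by apply: integral_ge0 => x _. Qed.

HB.instance Definition _ := isMeasure.Build _ _ _ density density0 density_ge0
  (semi_sigma_additive_nng_induced mf f0).

Definition density_measure : {measure set T -> \bar R} := density.

End density_measure.

(** Uniqueness of measures shaped for the substitution below: the star density blows up at 1, so
    segments are compared, and masses are finite, only strictly to the right of 1. *)
Lemma measure_eq_gt1 {R : realType} (m1 m2 : {measure set (measurableTypeR R) -> \bar R}) :
  (forall A : set R, measurable A -> A `<=` `]-oo, 1%R]%classic -> m1 A = 0 /\ m2 A = 0) ->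
  (forall p q : R, (1 < p)%R -> m1 `[p, q]%classic = m2 `[p, q]%classic) ->
  (forall p q : R, (1 < p)%R -> m1 `[p, q]%classic < +oo) ->
  forall A : set R, measurable A -> m1 A = m2 A.
Proof.
move=> m0 m12 moo A mA.
(* Adding all Borel sets left of 1, which are null for both measures, makes this pi-system generate
   the Borel sets and admit an exhausting sequence. *)
pose G : set (set R) := [set B : set R | (measurable B /\ B `<=` `]-oo, 1%R]%classic) \/
  exists p q : R, (1 < p)%R /\ B = `[p, q]%classic].
pose g (k : nat) : set R := if k is n.+1 then `[(1 + n.+1%:R^-1)%R, (1 + n.+1%:R)%R]%classic
  else `]-oo, 1%R]%classic.
have near1 (y x : R) : (y < x)%R -> exists n, `[(y + n.+1%:R^-1)%R, (y + n.+1%:R)%R]%classic x.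
  move=> yx.
  have xy0 : (0 < x - y)%R by rewrite subr_gt0.
  pose N := maxn (Num.truncn (x - y)^-1) (Num.truncn (x - y)).
  exists N; rewrite /= in_itv/=; apply/andP; split.
    rewrite -lerBrDl -[leRHS]invrK lef_pV2 ?posrE ?invr_gt0//.
    rewrite (le_trans (ltW (truncnS_gt _)))// ler_nat ltnS.
    exact: leq_maxl.
  rewrite -lerBlDl (le_trans (ltW (truncnS_gt _)))// ler_nat ltnS.
  exact: leq_maxr.
apply: (@measure_unique _ R (measurableTypeR R) G g) => //.
- rewrite eqEsubset; split; last first.
    apply: smallest_sub; first exact: sigma_algebra_measurable.
    by move=> B [[]//|[p [q [_ ->]]]]; exact: measurable_itv.
  move: (RGenOInfty.measurableE R) => ->.
  apply: smallest_sub; first exact: smallest_sigma_algebra.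
  move=> _ [x ->].
  pose y := Num.max x 1%R.
  have -> : `]x, +oo[%classic = (`]x, +oo[%classic `&` `]-oo, 1%R]%classic) `|`
      \bigcup_n `[(y + n.+1%:R^-1)%R, (y + n.+1%:R)%R]%classic.
    apply/seteqP; split => z /=.
      rewrite !in_itv/= andbT => xz; have [z1|z1] := leP z 1%R; first by left.
      right; have [|n zn] := near1 y z; first by rewrite gt_max xz.
      by exists n.
    move=> [[]//|[n _]] /=; rewrite !in_itv/= andbT => /andP[+ _].
    apply: lt_le_trans; rewrite (le_lt_trans _ (_ : y < _)%R)//.
      by rewrite le_max lexx.
    by rewrite ltrDl invr_gt0.
  apply: (@measurableU _ (g_sigma_algebraType G)).
    apply: sub_sigma_algebra; left; split; last exact: subIsetr.
    by apply: measurableI; exact: measurable_itv.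
  apply: (@bigcupT_measurable _ (g_sigma_algebraType G)) => n.
  apply: sub_sigma_algebra; right; eexists; eexists; split; last by [].
  rewrite (le_lt_trans _ (_ : y < _)%R) ?le_max ?lexx ?orbT//.
  by rewrite ltrDl invr_gt0.
- move=> B C [[mB B1]|[p [q [p1 ->]]]].
    move=> GC; left; split; last by move=> z [/B1].
    apply: measurableI => //; case: GC => [[]//|[p [q [_ ->]]]].
    exact: measurable_itv.
  move=> [[mC C1]|[r [s [r1 ->]]]].
    left; split; last by move=> z [_ /C1].
    by apply: measurableI => //; exact: measurable_itv.
  right; exists (Num.max p r), (Num.min q s); split; first by rewrite lt_max p1.
  apply/seteqP; split => z /=; rewrite !in_itv/= ge_max le_min.
    by move=> [/andP[-> ->] /andP[-> ->]].
  by move=> /andP[/andP[-> ->] /andP[-> ->]].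
- case=> [|n]; first by left; split => //; exact: measurable_itv.
  right; eexists; eexists; split; last by [].
  by rewrite ltrDl invr_gt0.
- rewrite -subTset => x _; have [x1|x1] := leP x 1%R.
    by exists 0%N.
  by have [n xn] := near1 _ _ x1; exists n.+1.
- move=> B [[mB B1]|[p [q [p1 ->]]]]; last exact: m12.
  by have [-> ->] := m0 _ mB B1.
- case=> [|n] /=; last by apply: moo; rewrite ltrDl invr_gt0.
  by have [|->//] := m0 _ _ (fun x h => h); exact: measurable_itv.
Qed.

Local Close Scope ereal_scope.

(** * The one-dimensional substitution between radii *)

Section radial_substitution.
Context {R : realType} (n : nat).
Notation mu := (@lebesgue_measure R).

Definition hyp_density (s : R) : R := (Num.sqrt (1 + s ^+ 2))^-1.
(** The beta-star intensity at norm [t] for [beta = d = n.+1], divided by [lambda]. *)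
Definition star_density (t : R) : R := 2 ^+ n.+1 / (t ^+ 2 - 1) ^+ n.+1.

(** If [t = coth (r / 2)], this is [sinh r]; it inverts [inv_radius] on []1, +oo[]. *)
Let sig (t : R) : R := 2 * t / (t ^+ 2 - 1).
Let sig' (t : R) : R := - (2 * (t ^+ 2 + 1) / (t ^+ 2 - 1) ^+ 2).

Let sqgt1 (t : R) : 1 < t -> 0 < t ^+ 2 - 1.
Proof. by move=> t1; nra. Qed.

Let is_derive_sig (t : R) : 1 < t -> is_derive t 1 sig (sig' t).
Proof.
move=> t1; have t2 := sqgt1 t1.
apply: is_derive_eq.
  apply: is_deriveM => //.
  apply: is_deriveV => //; rewrite gt_eqF//.
rewrite /sig'.
rewrite /GRing.scale/= !mulr1 subr0; field; exact: lt0r_neq0.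
Qed.

Let continuous_sig' (t : R) : 1 < t -> {for t, continuous sig'}.
Proof.
move=> t1; apply: cvgN; apply: cvgM.
  by apply: cvgM; [exact: cvg_cst|apply: cvgD; [exact: exprn_continuous|exact: cvg_cst]].
apply: cvgV; first by rewrite expf_neq0// gt_eqF// sqgt1.
apply: (@continuous_comp _ _ _ (fun t : R => t ^+ 2 - 1) (fun x : R => x ^+ 2)).
  by apply: cvgB; [exact: exprn_continuous|exact: cvg_cst].
exact: exprn_continuous.
Qed.

Let derive1_sig (t : R) : 1 < t -> derive1 sig t = sig' t.
Proof. by move=> t1; rewrite derive1E; exact: (@derive_val _ _ _ _ _ _ _ (is_derive_sig t1)). Qed.

Let cvg_derive1_sig (t : R) : 1 < t -> derive1 sig x @[x --> t] --> sig' t.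
Proof.
move=> t1; apply: cvg_trans (continuous_sig' t1).
apply: near_eq_cvg; near=> x; apply/esym/derive1_sig.
by near: x; exact: lt_nbhsr.
Unshelve. all: by end_near. Qed.

Let sig_dec (s t : R) : 1 < s -> s < t -> sig t < sig s.
Proof.
move=> s1 st; have t1 := lt_trans s1 st.
rewrite /sig ltr_pdivrMr ?sqgt1// mulrAC ltr_pdivlMr ?sqgt1//.
rewrite -subr_gt0 (_ : _ - _ = 2 * ((t - s) * (s * t + 1))); last by ring.
rewrite !mulr_gt0// ?subr_gt0//; nra.
Qed.

Lemma continuous_hyp_density : continuous hyp_density.
Proof.
move=> s; apply: cvgV.
  by rewrite gt_eqF// sqrtr_gt0 ltr_pwDl// sqr_ge0.
apply: continuous_comp; last exact: sqrt_continuous.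
by apply: cvgD; [exact: cvg_cst|exact: exprn_continuous].
Qed.

Local Open Scope ereal_scope.

Let subst_itv (p q : R) : (1 < p)%R -> (p <= q)%R ->
  \int[mu]_(s in `[sig q, sig p]) (s ^+ n * hyp_density s)%:E =
  \int[mu]_(t in `[p, q]) (t ^+ n * star_density t)%:E.
Proof.
move=> p1 pq.
have cs t : (p <= t)%R -> sig x @[x --> t] --> sig t.
  move=> pt; apply: differentiable_continuous; apply/derivable1_diffP.
  exact: (@ex_derive _ _ _ _ _ _ _ (is_derive_sig (lt_le_trans p1 pt))).
rewrite (@integration_by_substitution_decreasing R sig (fun s => s ^+ n * hyp_density s)%R)//.
- apply: eq_integral => t; rewrite inE/= in_itv/= => /andP[pt tq].
  have t1 := lt_le_trans p1 pt; rewrite !fctE derive1_sig//; congr EFin.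
  rewrite /= /hyp_density /star_density /sig /sig'.
  have t2 := sqgt1 t1.
  (* [1 + sig t ^ 2] is a perfect square, so the root in [hyp_density] disappears and only a
     rational identity remains. *)
  rewrite (_ : 1 + _ = ((t ^+ 2 + 1) / (t ^+ 2 - 1)) ^+ 2)%R; last first.
    by field; exact: lt0r_neq0.
  rewrite sqrtr_sqr ger0_norm; last by rewrite divr_ge0 ?(ltW t2)// addr_ge0// sqr_ge0.
  rewrite exprMn exprVn exprMn !(exprSr _ n).
  by field; rewrite lt0r_neq0 ?expf_neq0 ?lt0r_neq0// ltr_wpDl ?sqr_ge0.
- move=> x y; rewrite !in_itv/= => /andP[px _] /andP[py _] xy.
  by apply: sig_dec => //; exact: lt_le_trans p1 py.
- move=> x; rewrite in_itv/= => /andP[px _].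
  have x1 := lt_trans p1 px.
  by have := cvg_derive1_sig x1; rewrite -(derive1_sig x1).
- apply: cvgP; apply: cvg_at_right_filter; exact: cvg_derive1_sig.
- apply: cvgP; apply: cvg_at_left_filter; apply: cvg_derive1_sig.
  exact: lt_le_trans pq.
- split.
  + move=> x; rewrite in_itv/= => /andP[px _].
    exact: (@ex_derive _ _ _ _ _ _ _ (is_derive_sig (lt_trans p1 px))).
  + by apply: cvg_at_right_filter; exact: cs.
  + by apply: cvg_at_left_filter; exact: cs.
- apply: continuous_subspaceT => x; apply: cvgM; first exact: exprn_continuous.
  exact: continuous_hyp_density.
Qed.

(** The effect of [star_map] on norms: [coth (r / 2)] when [s = sinh r]. *)
Definition inv_radius (s : R) : R := s / (Num.sqrt (1 + s ^+ 2) - 1).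

Let sqrt_gt1 (s : R) : (0 < s)%R -> (1 < Num.sqrt (1 + s ^+ 2))%R.
Proof.
move=> s0; rewrite -[ltLHS]sqrtr1 ltr_sqrt ?ltrDl ?exprn_gt0//.
by rewrite ltr_pwDl// sqr_ge0.
Qed.

Let sqr_sqrt1 (s : R) : (Num.sqrt (1 + s ^+ 2) ^+ 2 = 1 + s ^+ 2)%R.
Proof. by rewrite sqr_sqrtr// addr_ge0// sqr_ge0. Qed.

Lemma inv_radius_gt1 (s : R) : (0 < s)%R -> (1 < inv_radius s)%R.
Proof.
move=> s0; have r1 := sqrt_gt1 s0; have r2 := sqr_sqrt1 s.
rewrite /inv_radius ltr_pdivlMr ?subr_gt0// mul1r.
set r := Num.sqrt _ in r1 r2 *; nra.
Qed.

(** Isolate the root and square: the difference of the squares is [s] times the difference of the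
    two sides of the other inequality, after clearing its denominator. *)
Lemma inv_radius_le (s q : R) : (0 < s)%R -> (1 < q)%R ->
  (inv_radius s <= q)%R = (sig q <= s)%R.
Proof.
move=> s0 q1; have r1 := sqrt_gt1 s0; have r2 := sqr_sqrt1 s; have q2 := sqgt1 q1.
rewrite /inv_radius /sig ler_pdivrMr ?subr_gt0// ler_pdivrMr//.
set r := Num.sqrt _ in r1 r2 *.
rewrite mulrBr mulr1 lerBrDr.
rewrite -(@ler_pXn2r _ 2)// ?nnegrE; [|nra|nra].
rewrite exprMn r2 -subr_ge0 -[RHS]subr_ge0.
rewrite (_ : _ - _ = s * (s * (q ^+ 2 - 1) - 2 * q))%R; last by ring.
by rewrite pmulr_rge0.
Qed.

Lemma inv_radius_ge (s q : R) : (0 < s)%R -> (1 < q)%R ->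
  (q <= inv_radius s)%R = (s <= sig q)%R.
Proof.
move=> s0 q1; have r1 := sqrt_gt1 s0; have r2 := sqr_sqrt1 s; have q2 := sqgt1 q1.
rewrite /inv_radius /sig ler_pdivlMr ?subr_gt0// ler_pdivlMr//.
set r := Num.sqrt _ in r1 r2 *.
rewrite mulrBr mulr1 lerBlDr.
rewrite -(@ler_pXn2r _ 2)// ?nnegrE; [|nra|nra].
rewrite exprMn r2 -subr_ge0 -[RHS]subr_ge0.
rewrite (_ : _ - _ = s * (2 * q - s * (q ^+ 2 - 1)))%R; last by ring.
by rewrite pmulr_rge0.
Qed.

Lemma inv_radius_le0 (s : R) : (s <= 0)%R -> (inv_radius s <= 0)%R.
Proof.
move=> s0; rewrite /inv_radius mulr_le0_ge0// invr_ge0 subr_ge0.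
by rewrite -[leLHS]sqrtr1 ler_sqrt ?lerDl ?sqr_ge0// addr_ge0// sqr_ge0.
Qed.

Lemma measurable_inv_radius : measurable_fun setT inv_radius.
Proof.
apply: measurable_fun_divr => //; apply: measurable_funB => //.
apply: continuous_measurable_fun => s.
apply: continuous_comp; last exact: sqrt_continuous.
by apply: cvgD; [exact: cvg_cst|exact: exprn_continuous].
Qed.

Lemma hyp_density_ge0 (s : R) : (0 <= hyp_density s)%R.
Proof. by rewrite invr_ge0 sqrtr_ge0. Qed.

Lemma star_density_ge0 (t : R) : (1 < t)%R -> (0 <= star_density t)%R.
Proof. by move=> t1; rewrite divr_ge0 ?exprn_ge0// ltW// sqgt1. Qed.

Let f1 (s : measurableTypeR R) : \bar R := (pos_pow n s * hyp_density s)%:E.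
Let f2 (t : measurableTypeR R) : \bar R :=
  (if (1 < t)%R then t ^+ n * star_density t else 0)%:E.

Let f1_ge0 s : 0 <= f1 s.
Proof. by rewrite lee_fin mulr_ge0 ?pos_pow_ge0// hyp_density_ge0. Qed.

Let f2_ge0 t : 0 <= f2 t.
Proof.
rewrite lee_fin; case: ifPn => // t1.
by rewrite mulr_ge0 ?star_density_ge0// exprn_ge0// (le_trans ler01)// ltW.
Qed.

Let mf1 : measurable_fun setT f1.
Proof.
apply/measurable_EFinP; apply: measurable_funM; first exact: measurable_pos_pow.
exact: continuous_measurable_fun continuous_hyp_density.
Qed.

Let mf2 : measurable_fun setT f2.
Proof.
apply/measurable_EFinP; apply: measurable_fun_ifT => //=.
  exact: measurable_fun_ltr.
apply: measurable_funM => //; apply: measurable_fun_divr => //.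
by apply: measurable_funX; apply: measurable_funB.
Qed.

(** Rays meet a measurable set in arbitrary Borel sets, so the substitution on segments is extended
    by uniqueness of measures. *)
Lemma radial_substitution (A : set R) : measurable A ->
  \int[mu]_(s in inv_radius @^-1` A) f1 s = \int[mu]_(t in A) f2 t.
Proof.
move=> mA.
have mtau : measurable_fun setT (inv_radius : measurableTypeR R -> measurableTypeR R).
  exact measurable_inv_radius.
pose m1 := density_measure mu mf1 f1_ge0.
pose m2 := density_measure mu mf2 f2_ge0.
have preim (p q : R) : (1 < p)%R -> (p <= q)%R ->
    inv_radius @^-1` `[p, q]%classic = `[sig q, sig p]%classic.
  move=> p1 pq; have q1 := lt_le_trans p1 pq.
  apply/seteqP; split => s /=; rewrite !in_itv/=.
    have [s0|s0] := leP s 0%R; last by rewrite inv_radius_le// inv_radius_ge// andbC.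
    move=> /andP[ps _]; have := le_trans ps (inv_radius_le0 s0).
    by rewrite leNgt (lt_trans _ p1).
  have sq0 : (0 < sig q)%R.
    by rewrite divr_gt0 ?sqgt1// mulr_gt0// (lt_trans ltr01).
  move=> /andP[qs sp]; have s0 := lt_le_trans sq0 qs.
  by rewrite inv_radius_le// inv_radius_ge// sp.
have m1E (p q : R) : (1 < p)%R -> (p <= q)%R ->
    \int[mu]_(s in inv_radius @^-1` `[p, q]%classic) f1 s =
    \int[mu]_(s in `[sig q, sig p]) (s ^+ n * hyp_density s)%:E.
  move=> p1 pq; rewrite preim//; apply: eq_integral => s; rewrite inE/= in_itv/=.
  have q1 := lt_le_trans p1 pq.
  have sq0 : (0 < sig q)%R.
    by rewrite divr_gt0 ?sqgt1// mulr_gt0// (lt_trans ltr01).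
  by move=> /andP[/(lt_le_trans sq0) s0 _]; rewrite /f1 /pos_pow s0.
have empty (p q : R) : (q < p)%R -> `[p, q]%classic = set0.
  by move=> qp; rewrite set_itv_ge// bnd_simp -ltNge.
pose m1' B := \int[mu]_(s in inv_radius @^-1` B) f1 s.
pose m2' B := \int[mu]_(t in B) f2 t.
apply: (@measure_eq_gt1 R
  (pushforward m1 (inv_radius : measurableTypeR R -> measurableTypeR R)) m2) => //.
- move=> B mB B1; change (m1' B = 0 /\ m2' B = 0); split; apply: integral0_eq => t.
    move=> /B1; rewrite /= in_itv/= => t1; rewrite /f1 /pos_pow.
    case: ifPn => [/inv_radius_gt1|_]; last by rewrite mul0r.
    by rewrite ltNge t1.
  by move=> /B1; rewrite /= in_itv/= => t1; rewrite /f2 ltNge t1.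
- move=> p q p1; change (m1' `[p, q]%classic = m2' `[p, q]%classic).
  have [pq|qp] := leP p q; last first.
    by rewrite empty// /m1' preimage_set0 /m2' !integral_set0.
  rewrite /m1' m1E// subst_itv//; apply: eq_integral => t; rewrite inE/= in_itv/=.
  by move=> /andP[/(lt_le_trans p1) t1 _]; rewrite /f2 t1.
(* Finiteness is read off on the [s] side, where the integrand is continuous on the compact segment
   [[sig q, sig p]]. *)
- move=> p q p1; change (m1' `[p, q]%classic < +oo).
  have [pq|qp] := leP p q; last first.
    by rewrite empty// /m1' preimage_set0 !integral_set0.
  rewrite /m1' m1E//; apply: integrable_lty; first exact: measurable_itv.
  apply: continuous_compact_integrable; first exact: segment_compact.
  apply: continuous_subspaceT => x; apply: cvgM; first exact: exprn_continuous.
  exact: continuous_hyp_density.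
Qed.

End radial_substitution.

(** * Change of variables along [star_map] *)

Section change_of_variables.
Context {R : realType} (n : nat).
Notation mu := (@lebesgue_measure R).

Definition star_map m (v : 'rV[R]_m) : 'rV[R]_m :=
  (Num.sqrt (1 + dotv v v) - 1)^-1 *: v.
Arguments star_map {m} v.

Lemma measurable_scaler_rV m d (T : measurableType d) (r : T -> R) (f : T -> 'rV[R]_m) :
  measurable_fun setT r -> measurable_fun setT f ->
  measurable_fun setT (fun t => r t *: f t).
Proof.
move=> mr mf; apply: measurable_fun_rVP => i; under eq_fun do rewrite mxE.
by apply: measurable_funM => //; exact: (measurableT_comp (measurable_coord_rV i)).
Qed.

Lemma measurable_sqrt d (T : measurableType d) (f : T -> R) :
  measurable_fun setT f -> measurable_fun setT (fun t => Num.sqrt (f t)).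
Proof.
move=> mf; apply: (@measurableT_comp _ _ _ _ _ _ (@Num.sqrt R)) => //.
by apply: continuous_measurable_fun; exact: sqrt_continuous.
Qed.

Lemma measurable_star_map m : measurable_fun setT (@star_map m).
Proof.
apply: measurable_scaler_rV => //.
apply: (@measurableT_comp _ _ _ _ _ _ (@GRing.inv R)); first exact: measurable_invr.
apply: measurable_funB => //; apply: measurable_sqrt; apply: measurable_funD => //.
exact: measurable_dotv.
Qed.

Lemma star_map_ray m (x : 'rV[R]_m) s : x != 0 -> 0 < s ->
  star_map ((s / enorm x) *: x) = (inv_radius s / enorm x) *: x.
Proof.
move=> x0 s0; have nx : 0 < enorm x by rewrite enorm_gt0.
rewrite /star_map /inv_radius dotvZl dotvZr -sqr_enorm scalerA.
rewrite (_ : s / enorm x * _ = s ^+ 2); last by field; rewrite gt_eqF.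
by rewrite mulrCA mulrA.
Qed.

Lemma measurable_neq0_rV m : measurable [set v : 'rV[R]_m | v != 0].
Proof.
rewrite (_ : mkset _ = (@enorm R m) @^-1` `]0, +oo[%classic).
  by rewrite -[X in measurable X]setTI; exact: measurable_enorm.
by apply/seteqP; split => v /=; rewrite in_itv/= andbT enorm_gt0.
Qed.

Lemma measurable_outside_ball m : measurable (@outside_ball R m).
Proof.
rewrite (_ : outside_ball m = (@enorm R m) @^-1` `]1, +oo[%classic).
  by rewrite -[X in measurable X]setTI; exact: measurable_enorm.
by apply/seteqP; split => v /=; rewrite in_itv/= andbT.
Qed.

Local Open Scope ereal_scope.

Lemma change_of_variables_star_map (A : set 'rV[R]_n.+1) : measurable A ->
  \int[lebesgue_rV n.+1]_(v in [set v | v != 0%R] `&` star_map @^-1` A)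
     (hyp_density (enorm v))%:E =
  \int[lebesgue_rV n.+1]_(y in A `&` outside_ball n.+1) (star_density n (enorm y))%:E.
Proof.
move=> mA.
have mB : measurable ([set v : 'rV[R]_n.+1 | v != 0%R] `&` star_map @^-1` A).
  apply: measurableI; first exact: measurable_neq0_rV.
  by rewrite -[X in measurable X]setTI; exact: measurable_star_map.
have mC : measurable (A `&` outside_ball n.+1).
  by apply: measurableI => //; exact: measurable_outside_ball.
pose F1 := (fun v => (hyp_density (enorm v))%:E) \_
  ([set v : 'rV[R]_n.+1 | v != 0%R] `&` star_map @^-1` A).
pose F2 := (fun y => (star_density n (enorm y))%:E) \_ (A `&` outside_ball n.+1).
have F1_ge0 v : 0 <= F1 v.
  by apply: erestrict_ge0 => w _; rewrite lee_fin hyp_density_ge0.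
have F2_ge0 v : 0 <= F2 v.
  by apply: erestrict_ge0 => w [_ w1]; rewrite lee_fin star_density_ge0.
have mF1 : measurable_fun setT F1.
  apply/(measurable_restrictT _ mB)/measurable_funTS/measurable_EFinP.
  exact: (measurableT_comp (continuous_measurable_fun continuous_hyp_density)
    (@measurable_enorm R _)).
have mF2 : measurable_fun setT F2.
  apply/(measurable_restrictT _ mC)/measurable_funTS/measurable_EFinP.
  apply: measurable_fun_divr => //; apply: measurable_funX.
  by apply: measurable_funB => //; apply: measurable_funX; exact: measurable_enorm.
rewrite [LHS]integral_mkcond [RHS]integral_mkcond -/F1 -/F2.
have c0 := @radial_const_gt0 R n; have cfin := @radial_const_fin R n.
(* Multiplying by the cancellable [radial_const] turns both sides into radial averages. *)
suff : radial_const n * \int[lebesgue_rV n.+1]_v F1 v =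
       radial_const n * \int[lebesgue_rV n.+1]_v F2 v :> \bar R.
  rewrite -(fineK cfin); set c := fine _.
  have cn0 : c != 0%R by rewrite gt_eqF// fine_gt0// c0 ltey_eq cfin.
  move/(congr1 (fun x => c^-1%:E * x)).
  by rewrite !muleA -!EFinM mulVf// !mul1e.
have F10 : F1 0%R = 0 by rewrite /F1 patchE memNset// => -[]; rewrite /= eqxx.
have F20 : F2 0%R = 0.
  by rewrite /F2 patchE memNset// => -[_]; rewrite /outside_ball/= enorm0 ltr10.
rewrite -(radial_averageE mF1 F1_ge0 F10) -(radial_averageE mF2 F2_ge0 F20).
apply: eq_radial_average => x x0.
have nx : (0 < enorm x)%R by rewrite enorm_gt0.
have nsx s : (0 < s)%R -> enorm ((s / enorm x) *: x)%R = s.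
  move=> s0; rewrite enormZ gtr0_norm ?divr_gt0//.
  by rewrite -mulrA mulVf ?mulr1// gt_eqF.
have mD : measurable [set t : R | A ((t / enorm x) *: x)%R].
  have mr : measurable_fun setT (fun t : R => (t / enorm x) *: x)%R.
    by apply: measurable_scaler_rV => //; exact: measurable_fun_divr.
  by rewrite -[X in measurable X]setTI; exact: mr.
(* On the ray through [x], [star_map] acts by [inv_radius] on the norm, and [A] becomes the Borel
   set of those [t] for which the point at distance [t] lies in [A]. *)
have := radial_substitution n mD.
rewrite integral_mkcond [in X in _ = X]integral_mkcond => E.
rewrite [RHS](_ : _ = \int[mu]_t (((fun t : measurableTypeR R =>
    (if (1 < t)%R then t ^+ n * star_density n t else 0)%:E) \_
   [set t : R | A ((t / enorm x) *: x)%R]) t)); last first.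
  apply: eq_integral => s _; rewrite /F2 !patchE /pos_pow.
  have [s0|s0] := leP s 0%R.
    rewrite mul0e; case: ifPn => // _.
    by rewrite ltNge (le_trans s0 ler01).
  case: ifPn => [|].
    rewrite inE => -[As]; rewrite /outside_ball/= nsx// => s1.
    by rewrite mem_set//= s1.
  rewrite notin_setE => nAs; rewrite mule0; case: ifPn => //.
  rewrite inE/= => As; case: ifPn => // s1; exfalso; apply: nAs; split => //.
  by rewrite /outside_ball/= nsx.
rewrite -E; apply: eq_integral => s _; rewrite /F1 !patchE /pos_pow.
have [s0|s0] := leP s 0%R.
  by rewrite mul0e mul0r; case: ifPn.
have sx0 : ((s / enorm x) *: x != 0)%R.
  by rewrite scaler_eq0 negb_or x0 gt_eqF// divr_gt0.
have mem : ((s / enorm x) *: x \in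
    [set v : 'rV[R]_n.+1 | v != 0%R] `&` star_map @^-1` A)%R =
    (s \in inv_radius @^-1` [set t : R | A ((t / enorm x) *: x)%R]).
  apply/idP/idP; rewrite !inE/= star_map_ray//.
  by case.
by rewrite mem; case: ifPn => _; rewrite ?mule0// nsx// EFinM.
Qed.

End change_of_variables.

(** Sylvester's identity: both sides are the determinant of the same block matrix [N], factored into
    triangular blocks in two ways. *)
Lemma det_one_sub_rank1 {R : comNzRingType} m (u : 'rV[R]_m) :
  \det (1%:M - u^T *m u) = 1 - (u *m u^T) ord0 ord0.
Proof.
pose N : 'M[R]_(1 + m) := block_mx 1%:M u u^T 1%:M.
have E1 : N = block_mx 1%:M 0 u^T 1%:M *m block_mx 1%:M u 0 (1%:M - u^T *m u).
  by rewrite mulmx_block !mul1mx !mulmx1 !mul0mx !addr0 addrC subrK.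
have E2 : N = block_mx (1%:M - u *m u^T) u 0 1%:M *m block_mx 1%:M 0 u^T 1%:M.
  by rewrite mulmx_block !mul1mx !mulmx1 !mul0mx !mulmx0 !add0r subrK.
have : \det N = \det N by [].
rewrite {1}E1 E2 !det_mulmx !det_ublock !det_lblock !det1 !mul1r !mulr1 => ->.
by rewrite det_mx11 !mxE.
Qed.

(** * The volume density in the global chart *)

Section hyperbolic_volume.
Context {R : realType} (d : nat).

(** Turns a directional derivative into a one-variable one, so that the chart can be differentiated
    entry by entry. *)
Lemma derive_line (V W : normedModType R) (f : V -> W) a v :
  'D_v f a = 'D_1 (fun h : R => f (h *: v + a)) 0.
Proof.
rewrite /derive; congr (lim _).
rewrite (_ : (fun h => h^-1 *: ((f \o shift a) (h *: v) - f a)) =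
  (fun h : R => h^-1 *:
    (((fun h0 : R => f (h0 *: v + a)) \o shift 0) (h *: 1) -
     f (0 *: v + a))))//.
by apply/funext => h /=; rewrite addr0 scale0r add0r [h *: 1]mulr1.
Qed.

Lemma derive_hyp_chart (v : 'rV[R]_d) (i : 'I_d) :
  'D_(delta_mx ord0 i) (@hyp_chart R d) v =
  rV_cons (v ord0 i / Num.sqrt (1 + dotv v v), delta_mx ord0 i).
Proof.
have r0 : 0 < 1 + dotv v v by rewrite ltr_pwDl// dotv_ge0.
pose M (h : R) := hyp_chart (h *: delta_mx ord0 i + v).
pose q (h : R) := 1 + (h ^+ 2 + (2 * v ord0 i) * h + dotv v v).
have dotE h : 1 + dotv (h *: delta_mx ord0 i + v) (h *: delta_mx ord0 i + v) = q h.
  have dv (w : 'rV[R]_d) : dotv (delta_mx ord0 i) w = w ord0 i.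
    rewrite /dotv (bigD1 i)//= big1 ?addr0; first by rewrite mxE !eqxx mul1r.
    by move=> j ji; rewrite mxE (negPf ji) andbF mul0r.
  rewrite /q !(dotvDl, dotvDr, dotvZl, dotvZr) (dotvC v) !dv mxE !eqxx/=; ring.
have dq : is_derive (0 : R) 1 q (2 * v ord0 i).
  apply: is_derive_eq.
  by rewrite /GRing.scale/=; ring.
have q0 : q 0 = 1 + dotv v v by rewrite /q expr0n mulr0 !add0r.
have ds : is_derive (0 : R) 1 (fun h => Num.sqrt (q h))
    (v ord0 i / Num.sqrt (1 + dotv v v)).
  have h1 : is_derive (q 0) 1 Num.sqrt (2 * Num.sqrt (q 0))^-1.
    by apply: is_derive1_sqrt; rewrite q0.
  apply: is_derive_eq (is_derive1_comp h1 dq) _.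
  rewrite q0; field; by rewrite gt_eqF// sqrtr_gt0.
have dM (k : 'I_1) (j : 'I_d.+1) : is_derive (0 : R) 1 (fun h => M h k j)
    (rV_cons (v ord0 i / Num.sqrt (1 + dotv v v), delta_mx ord0 i) k j).
  rewrite (ord1 k); have [j' ->|->] := unliftP ord0 j.
    rewrite rV_consES/=.
    under eq_fun do rewrite /M /hyp_chart rV_consES !mxE.
    apply: is_derive_eq.
    by rewrite /GRing.scale/= mxE; ring.
  rewrite rV_consE0/=.
  by under eq_fun do rewrite /M /hyp_chart rV_consE0/= dotE.
rewrite derive_line derive_mx.
  by apply/rowP => j; rewrite mxE; exact: (@derive_val _ _ _ _ _ _ _ (dM ord0 j)).
by apply/derivable_mxP => k j; exact: (@ex_derive _ _ _ _ _ _ _ (dM k j)).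
Qed.

(** The time coordinate has gradient [u = v / sqrt (1 + |v|^2)] and enters the metric with a minus
    sign, so the metric is the identity minus a rank-one matrix, with determinant [1 - |u|^2]. *)
Lemma det_hyp_metric (v : 'rV[R]_d) : \det (hyp_metric v) = (1 + dotv v v)^-1.
Proof.
have r0 : 0 < 1 + dotv v v by rewrite ltr_pwDl// dotv_ge0.
pose u := (Num.sqrt (1 + dotv v v))^-1 *: v.
have -> : hyp_metric v = 1%:M - u^T *m u.
  apply/matrixP => i j; rewrite !mxE !derive_hyp_chart /lorentz !rV_consE0/=.
  under eq_bigr do rewrite !rV_consES/= !mxE eqxx/=.
  rewrite big_ord1 !mxE opprB; congr (_ - _); last by ring.
  rewrite (bigD1 i)//= big1 ?addr0; first by rewrite eqxx mul1r.
  by move=> k ki; rewrite (negPf ki) mul0r.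
rewrite det_one_sub_rank1 mxE.
have -> : \sum_j u ord0 j * u^T j ord0 = dotv u u.
  by apply: eq_bigr => j _; rewrite [u^T _ _]mxE.
rewrite dotvZl dotvZr mulrA -expr2 exprVn sqr_sqrtr ?(ltW r0)//.
by field; rewrite gt_eqF.
Qed.

Lemma hyp_volumeE (B : set 'rV[R]_d.+1) :
  hyp_volume B = (\int[lebesgue_rV d]_(v in @hyp_chart R d @^-1` B)
    (hyp_density (enorm v))%:E)%E.
Proof.
apply: eq_integral => v _; congr EFin.
rewrite det_hyp_metric /hyp_density sqr_enorm.
by rewrite sqrtrV// addr_ge0// dotv_ge0.
Qed.

End hyperbolic_volume.

(** * The cell in gnomonic coordinates *)

Section typical_cell_geometry.
Context {R : realType}.

Lemma cauchy_schwarz_dotv d (u v : 'rV[R]_d) :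
  dotv u v ^+ 2 <= dotv u u * dotv v v.
Proof.
have [->|v0] := eqVneq v 0.
  by rewrite /dotv [X in X ^+ 2]big1 ?expr0n/= ?mulr_ge0 ?dotv_ge0// => i _; rewrite mxE mulr0.
have b0 : 0 < dotv v v by rewrite lt0r dotvv_eq0 v0 dotv_ge0.
(* Up to the factor [|v|^2], this vector is the component of [u] orthogonal to [v]. *)
have := dotv_ge0 (dotv v v *: u + - dotv u v *: v).
rewrite !(dotvDl, dotvDr, dotvZl, dotvZr) (dotvC v u).
rewrite (_ : _ + _ = dotv v v * (dotv u u * dotv v v - dotv u v ^+ 2)); last by ring.
by rewrite pmulr_rge0// subr_ge0.
Qed.

Lemma dotv_le_enorm d (u v : 'rV[R]_d) : `|dotv u v| <= enorm u * enorm v.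
Proof.
rewrite -sqrtr_sqr -sqrtrM ?dotv_ge0// ler_sqrt ?cauchy_schwarz_dotv//.
by rewrite mulr_ge0// dotv_ge0.
Qed.

Lemma ler_arcosh (a b : R) : 1 <= a -> 1 <= b -> (arcosh a <= arcosh b) = (a <= b).
Proof.
move=> a1 b1.
have p (x : R) : 1 <= x -> 0 < x + Num.sqrt (x ^+ 2 - 1).
  by move=> x1; rewrite ltr_pwDl ?sqrtr_ge0// (lt_le_trans ltr01).
rewrite /arcosh ler_ln ?posrE ?p//.
have mono (x y : R) : 1 <= x -> x <= y ->
    Num.sqrt (x ^+ 2 - 1) <= Num.sqrt (y ^+ 2 - 1).
  by move=> x1 xy; rewrite ler_sqrt; nra.
apply/idP/idP => [|ab]; last by rewrite lerD// mono.
by apply: contraTT; rewrite -!ltNge => ba; rewrite ltr_leD// mono// ltW.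
Qed.

Definition spatial d (z : 'rV[R]_d.+1) : 'rV[R]_d := \row_i z ord0 (lift ord0 i).

Lemma spatial_hyp_chart d (v : 'rV[R]_d) : spatial (hyp_chart v) = v.
Proof. by apply/rowP => i; rewrite mxE rV_consES. Qed.

Lemma lorentzE d (y z : 'rV[R]_d.+1) :
  lorentz y z = y ord0 ord0 * z ord0 ord0 - dotv (spatial y) (spatial z).
Proof. by congr (_ - _); apply: eq_bigr => i _; rewrite !mxE. Qed.

Lemma hyperboloidP d (z : 'rV[R]_d.+1) :
  hyperboloid d z <-> z = hyp_chart (spatial z).
Proof.
split=> [[]|->].
  rewrite lorentzE => z1 z0.
  rewrite [LHS]rV_cons_surj /hyp_chart -/(spatial z); congr (rV_cons (_, _)).
  rewrite (_ : 1 + _ = z ord0 ord0 ^+ 2); first by rewrite sqrtr_sqr gtr0_norm.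
  by rewrite -z1 subrK.
have r0 : 0 < 1 + dotv (spatial z) (spatial z) by rewrite ltr_pwDl// dotv_ge0.
split; last by rewrite rV_consE0 sqrtr_gt0.
rewrite lorentzE spatial_hyp_chart rV_consE0/= -expr2 sqr_sqrtr ?(ltW r0)//.
by rewrite addrK.
Qed.

Lemma hyp_chart0 d (v : 'rV[R]_d) : hyp_chart v ord0 ord0 = Num.sqrt (1 + dotv v v).
Proof. exact: rV_consE0. Qed.

(** Reversed Cauchy-Schwarz: [(1 + <u,v>)^2 <= (1 + |u|^2) (1 + |v|^2)] follows from Cauchy-Schwarz
    and [|u - v|^2 >= 0]. It places distances in the range where [arcosh] is monotone. *)
Lemma lorentz_ge1 d (u v : 'rV[R]_d) : 1 <= lorentz (hyp_chart u) (hyp_chart v).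
Proof.
rewrite lorentzE !spatial_hyp_chart !hyp_chart0 lerBrDr.
have [a0 b0] := (dotv_ge0 u, dotv_ge0 v).
rewrite -sqrtrM ?addr_ge0//; apply: le_trans (ler_norm _) _.
rewrite -sqrtr_sqr ler_sqrt ?mulr_ge0 ?addr_ge0//.
have := cauchy_schwarz_dotv u v; have := dotv_ge0 (u - v).
rewrite -scaleN1r !(dotvDl, dotvDr, dotvZl, dotvZr) (dotvC v u).
nra.
Qed.

Lemma spatial_origin d : spatial (hyp_origin d) = 0 :> 'rV[R]_d.
Proof. by apply/rowP => i; rewrite !mxE. Qed.

Lemma closer_to_origin d (u v : 'rV[R]_d) :
  (hyp_dist (hyp_chart u) (hyp_origin d) <= hyp_dist (hyp_chart u) (hyp_chart v)) =
  (dotv u v <= Num.sqrt (1 + dotv u u) * (Num.sqrt (1 + dotv v v) - 1)).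
Proof.
have -> : hyp_origin d = hyp_chart 0 :> 'rV[R]_d.+1.
  rewrite -(spatial_origin d); apply/hyperboloidP; split.
    rewrite lorentzE spatial_origin mxE !eqxx/= mulr1 (_ : dotv _ _ = 0) ?subr0//.
    by apply/eqP; rewrite dotvv_eq0.
  by rewrite mxE !eqxx/=.
rewrite ler_arcosh ?lorentz_ge1// !lorentzE !spatial_hyp_chart !hyp_chart0.
have -> : dotv (0 : 'rV[R]_d) 0 = 0 by apply/eqP; rewrite dotvv_eq0.
have -> : dotv u 0 = 0 by rewrite /dotv big1// => i _; rewrite mxE mulr0.
by rewrite addr0 sqrtr1 mulr1 subr0 lerBrDr -lerBrDl mulrBr mulr1.
Qed.

(** A nucleus at the origin constrains nothing, and [star_map] would send it to 0, inside the ball;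
    excluding it keeps all star atoms outside the ball. *)
Definition star_atoms d (Z : set 'rV[R]_d.+1) : set 'rV[R]_d :=
  [set star_map (spatial z) | z in Z `&` [set z | spatial z != 0]].

Definition open_unit_ball d : set 'rV[R]_d := [set x | enorm x < 1].

Lemma gnomonic_typical_cell d (Z : set 'rV[R]_d.+1) : Z `<=` hyperboloid d ->
  gnomonic @` typical_cell Z = @open_unit_ball d `&` convex_dual (star_atoms Z).
Proof.
move=> ZH.
have sq (v : 'rV[R]_d) : v != 0 -> 0 < Num.sqrt (1 + dotv v v) - 1.
  move=> v0; have b0 : 0 < dotv v v by rewrite lt0r dotvv_eq0 v0 dotv_ge0.
  by rewrite subr_gt0 -[ltLHS]sqrtr1 ltr_sqrt ?ltrDl// ltr_pwDl// ltW.
have sp (v : 'rV[R]_d) : 0 < Num.sqrt (1 + dotv v v).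
  by rewrite sqrtr_gt0 ltr_pwDl// dotv_ge0.
have gE (v : 'rV[R]_d) : gnomonic (hyp_chart v) = (Num.sqrt (1 + dotv v v))^-1 *: v.
  by apply/rowP => i; rewrite [LHS]mxE [RHS]mxE rV_consES hyp_chart0 mulrC.
have key (u v : 'rV[R]_d) : v != 0 ->
    (dotv ((Num.sqrt (1 + dotv u u))^-1 *: u) (star_map v) <= 1) =
    (dotv u v <= Num.sqrt (1 + dotv u u) * (Num.sqrt (1 + dotv v v) - 1)).
  move=> v0; rewrite dotvZl dotvZr mulrA -invfM mulrC ler_pdivrMr ?mul1r//.
  by rewrite mulr_gt0// sq.
apply/seteqP; split => [_ [y [Hy yZ] <-]|x [xB xZ]].
  move/hyperboloidP : (Hy) => yE; set u := spatial y in yE.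
  rewrite yE gE; split.
    rewrite /open_unit_ball/= enormZ gtr0_norm ?invr_gt0// mulrC ltr_pdivrMr// mul1r.
    by rewrite ltr_sqrt ?ltrDr// ltr_pwDl// dotv_ge0.
  move=> _ [z [Zz /= z0] <-]; rewrite key// -closer_to_origin -yE.
  by have /hyperboloidP <- := ZH _ Zz; exact: yZ.
(* The spatial part of the point of the hyperboloid that projects to [x]. *)
pose u := (Num.sqrt (1 - dotv x x))^-1 *: x.
have x1 : 0 < 1 - dotv x x.
  by rewrite subr_gt0 -sqr_enorm expr_lt1// enorm_ge0.
have uE : Num.sqrt (1 + dotv u u) = (Num.sqrt (1 - dotv x x))^-1.
  rewrite -sqrtrV ?(ltW x1)//; congr Num.sqrt.
  rewrite dotvZl dotvZr mulrA -invfM -expr2 sqr_sqrtr ?(ltW x1)//.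
  by field; rewrite gt_eqF.
have xE : (Num.sqrt (1 + dotv u u))^-1 *: u = x.
  by rewrite uE invrK scalerA divff ?scale1r// gt_eqF// sqrtr_gt0.
exists (hyp_chart u); last by rewrite gE.
split; first by apply/hyperboloidP; rewrite spatial_hyp_chart.
move=> z Zz; have /hyperboloidP -> := ZH _ Zz.
rewrite closer_to_origin.
have [z0|z0] := eqVneq (spatial z) 0; last first.
  by rewrite -key// xE; apply: xZ; exists z.
have d0 (v : 'rV[R]_d) : dotv v 0 = 0 by rewrite /dotv big1// => i _; rewrite mxE mulr0.
by rewrite z0 !d0 addr0 sqrtr1 subrr mulr0.
Qed.

End typical_cell_geometry.

(** * A countable criterion for the dual to miss a compact set *)

Section dual_misses_compact.
Context {R : realType} (d : nat).
Implicit Types (x y : 'rV[R]_d) (S K : set 'rV[R]_d).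

(** The norm dual to the sup norm: it controls the change of [<x, y>] when each coordinate of [x]
    moves by a bounded amount, as in rounding to a grid. *)
Definition l1norm y : R := \sum_(i < d) `|y ord0 i|.

Lemma l1norm_ge0 y : 0 <= l1norm y.
Proof. by apply: sumr_ge0 => i _. Qed.

Lemma measurable_l1norm : measurable_fun setT l1norm.
Proof.
apply: measurable_sum => i.
exact: (measurableT_comp (@normr_measurable _ _) (measurable_coord_rV i)).
Qed.

Lemma ler_dotv_l1norm x x' y e : (forall i, `|x ord0 i - x' ord0 i| <= e) ->
  dotv x y - e * l1norm y <= dotv x' y.
Proof.
move=> xx'; rewrite lerBlDr -lerBlDl /dotv -sumrB /l1norm mulr_sumr.
apply: ler_sum => i _; rewrite -mulrBl (le_trans (ler_norm _))// normrM.
by rewrite ler_wpM2r.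
Qed.

Lemma continuous_dotvl y : continuous (fun x => dotv x y).
Proof.
apply: continuous_big; [exact: add_continuous|move=> i _ x].
have h : {for x, continuous (fun x : 'rV[R]_d => x ord0 i)}.
  exact: coord_continuous.
exact: (cvgM h (cvg_cst _)).
Qed.

Lemma continuous_enorm : continuous (@enorm R d).
Proof.
move=> x; apply: (@continuous_comp _ _ _ (fun x => dotv x x) Num.sqrt);
  last exact: sqrt_continuous.
move: x; apply: continuous_big; [exact: add_continuous|move=> i _ x].
have h : {for x, continuous (fun x : 'rV[R]_d => x ord0 i)}.
  exact: coord_continuous.
exact: (cvgM h h).
Qed.

Definition grid_point (n : nat) (q : 'rV[int]_d) : 'rV[R]_d :=
  \row_i ((q ord0 i)%:~R / n.+1%:R).

Lemma near_grid_point n x :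
  exists q, forall i, `|x ord0 i - grid_point n q ord0 i| <= n.+1%:R^-1.
Proof.
exists (\row_i Num.floor (x ord0 i * n.+1%:R)) => i; rewrite !mxE.
have n0 : (0 : R) < n.+1%:R by [].
set t := x ord0 i * n.+1%:R.
rewrite (_ : _ - _ = (t - (Num.floor t)%:~R) / n.+1%:R); last first.
  by rewrite /t mulrBl mulfK// gt_eqF.
have := Num.Theory.floor_le t; have := floorD1_gt t; rewrite intrD1 => h1 h2.
rewrite ger0_norm ?divr_ge0 ?subr_ge0// ler_pdivrMr// mulVf ?gt_eqF// lerBlDl.
by rewrite ltW// addrC.
Qed.

(* [K] misses the dual as soon as, at some scale, each grid point close to [K]
   is cut off, with a margin, by a single element of [S]; compactness gives a
   uniform scale, and only countably many conditions on [S] are involved. *)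
Lemma dual_missP K S : compact K ->
  convex_dual S `&` K = set0 <->
  exists n, forall q : 'rV[int]_d,
    (exists2 x, K x & forall i, `|x ord0 i - grid_point n q ord0 i| <= n.+1%:R^-1) ->
    exists2 y, S y & 1 + n.+1%:R^-1 * l1norm y < dotv (grid_point n q) y.
Proof.
move=> cK; split=> [SK0|[n Hn]]; last first.
  rewrite -subset0 => x [xS Kx].
  have [q qx] := near_grid_point n x.
  have [|y Sy] := Hn q; first by exists x.
  have := @ler_dotv_l1norm (grid_point n q) x y n.+1%:R^-1.
  have := xS _ Sy => h1 h2 h3.
  have : dotv (grid_point n q) y - n.+1%:R^-1 * l1norm y <= dotv x y.
    by apply: h2 => i; rewrite distrC.
  move=> h4; suff : False by [].
  by move: (n.+1%:R^-1 * l1norm y) h3 h4 => t; lra.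
(* Twice the margin: one share is lost in passing from [x] to a grid point, the other is the margin
   left there. *)
pose P (n : nat) x := exists2 y, S y & 1 + 2 * (n.+1%:R^-1 * l1norm y) < dotv x y.
have : \forall n \near \oo, K `<=` P n.
  apply: (compact_near_coveringP _).1 => // x Kx.
  have [y Sy xy] : exists2 y, S y & 1 < dotv x y.
    apply: contrapT => h.
    have : (convex_dual S `&` K) x.
      split=> // y Sy; rewrite leNgt; apply/negP => xy; apply: h; by exists y.
    by rewrite SK0.
  pose e := (dotv x y - 1) / 2.
  have e0 : 0 < e by rewrite /e divr_gt0// subr_gt0.
  (* A mesh below [d0] makes the doubled margin less than [e]; the [+ 1] covers the case [y = 0]. *)
  pose d0 := e / (2 * (l1norm y + 1)).
  have d00 : 0 < d0.
    by rewrite /d0 divr_gt0// mulr_gt0// ltr_wpDl// l1norm_ge0.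
  have nx : \forall x' \near x, 1 + e < dotv x' y.
    apply: (cvgr_gt _ (@continuous_dotvl y x)); rewrite /e; lra.
  near=> x' n.
  exists y => //.
  have h1 : 1 + e < dotv x' y.
    by near: x'; exact: nx.
  have h2 : 2 * (n.+1%:R^-1 * l1norm y) < e.
    have l0 := l1norm_ge0 y.
    have n0 : 0 <= n.+1%:R^-1 :> R by rewrite invr_ge0.
    have nd : n.+1%:R^-1 < d0.
      by near: n; exact: (near_infty_natSinv_lt (PosNum d00)).
    move: nd; rewrite /d0 ltr_pdivlMr; [|by lra]; move: n.+1%:R^-1 n0 => t t0 td.
    by nra.
  by move: (n.+1%:R^-1 * l1norm y) h1 h2 => t; lra.
move=> [N _ /(_ N (leqnn N)) KP]; exists N => q [x Kx xq].
have [y Sy xy] := KP _ Kx; exists y => //.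
have := ler_dotv_l1norm (x := x) (x' := grid_point N q) y xq.
by move: (N.+1%:R^-1 * l1norm y) xy => t; lra.
Unshelve. all: by end_near. Qed.

End dual_misses_compact.

(** * Miss events and the Fell sigma-algebra *)

Section fell_sigma_algebra.
Context {R : realType} (d : nat).
Implicit Types (S K : set 'rV[R]_d).

Definition miss_sets : set (set (set 'rV[R]_d)) :=
  [set [set S | S `&` A = set0] | A in measurable].

Definition missType := g_sigma_algebraType miss_sets.
HB.instance Definition _ := Measurable.on missType.

Lemma measurable_miss (A : set 'rV[R]_d) : measurable A ->
  measurable ([set S | S `&` A = set0] : set missType).
Proof. by move=> mA; apply: sub_sigma_algebra; exists A. Qed.

Lemma measurable_dual_hit K : compact K ->
  measurable ([set S | convex_dual S `&` K !=set0] : set missType).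
Proof.
move=> cK.
pose A n q : set 'rV[R]_d :=
  [set y | 1 + n.+1%:R^-1 * l1norm y < dotv (grid_point n q) y].
have mA n q : measurable (A n q).
  have mB : measurable_fun setT (fun y : 'rV[R]_d =>
      1 + n.+1%:R^-1 * l1norm y < dotv (grid_point n q) y).
    apply: measurable_fun_ltr; last exact: measurable_dotv.
    apply: measurable_funD => //; apply: measurable_funM => //.
    exact: measurable_l1norm.
  have := mB measurableT [set true] I; rewrite setTI.
  by congr measurable; apply/seteqP; split=> y.
pose N n q := exists2 x, K x &
  forall i, `|x ord0 i - grid_point n q ord0 i| <= n.+1%:R^-1.
(* The negated criterion reads: for every [n] there is a [q]. Both range over countable types, and
   [N n q] concerns [K] alone, so this is a countable combination of miss events. *)
rewrite (_ : [set S | _] =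
    ~` \bigcup_n ~` \bigcup_(q in [set: 'rV[int]_d])
      [set S | N n q /\ S `&` A n q = set0]); last first.
  apply/seteqP; split => S /=.
    move=> h [n _ hn]; move: h => /set0P/eqP; apply.
    apply/(dual_missP _ cK); exists n => q Nq.
    apply: contrapT => h; apply: hn; exists q => //; split => //.
    by rewrite -subset0 => y [Sy Ay]; apply: h; exists y.
  move=> h; apply/set0P/eqP => /(dual_missP _ cK) [n hn]; apply: h.
  exists n => // -[q _ [/hn [y Sy Ay] SA]].
  by have : (S `&` A n q) y by []; rewrite SA.
apply: measurableC; apply: bigcupT_measurable => n; apply: measurableC.
apply: countable_bigcupT_measurable => [|q]; first exact: countableP.
have [Nq|Nq] := pselect (N n q).
  rewrite (_ : [set S | _] = [set S | S `&` A n q = set0]).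
    exact: measurable_miss.
  by apply/seteqP; split => S /= => [[]|].
rewrite (_ : [set S | _] = set0); first exact: measurable0.
by apply/seteqP; split => S //= => -[].
Qed.

(** The part of [K] in the open ball is not compact, but it is the union of its compact parts in the
    closed balls of radius [1 - 1 / (n + 1)]. *)
Lemma measurable_ball_dual_hit K : compact K ->
  measurable ([set S | (@open_unit_ball R d `&` convex_dual S) `&` K !=set0] :
    set missType).
Proof.
move=> cK.
pose K_ n := K `&` (@enorm R d) @^-1` `]-oo, 1 - n.+1%:R^-1]%classic.
have cK_ n : compact (K_ n).
  apply: compact_closedI => //.
  apply: closed_comp; last exact: interval_closed.
  by move=> x _; exact: continuous_enorm.
rewrite (_ : [set S | _] = \bigcup_n [set S | convex_dual S `&` K_ n !=set0]).
  by apply: bigcupT_measurable => n; exact: measurable_dual_hit.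
apply/seteqP; split => S /=.
  move=> [x [[x1 Sx] Kx]].
  have x10 : 0 < 1 - enorm x by rewrite subr_gt0.
  have [n _ /(_ n (leqnn n)) hn] := near_infty_natSinv_lt (PosNum x10).
  exists n => //; exists x; split => //; split => //=.
  by rewrite in_itv/= lerBrDl -lerBrDr ltW.
move=> [n _ [x [Sx [Kx /=]]]]; rewrite in_itv/= => xn.
exists x; split => //; split => //; rewrite /open_unit_ball/=.
by rewrite (le_lt_trans xn)// ltrBlDr ltrDl invr_gt0.
Qed.

Lemma measurable_fell_preimage (Xi : set 'rV[R]_d -> set 'rV[R]_d) :
  (forall K, compact K ->
    measurable ([set S | Xi S `&` K !=set0] : set missType)) ->
  forall H, fell_measurable H -> measurable (Xi @^-1` H : set missType).
Proof.
move=> mXi; pose E : set (set (set 'rV[R]_d)) :=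
  [set H | measurable (Xi @^-1` H : set missType)].
apply: (@smallest_sub _ _ _ E); last first.
  by move=> _ [K cK ->]; exact: mXi.
split.
- by rewrite /E/= preimage_set0.
- by move=> A EA; rewrite /E/= setTD preimage_setC; exact: measurableC.
- by move=> F EF; rewrite /E/= preimage_bigcup; exact: bigcupT_measurable.
Qed.

End fell_sigma_algebra.

Lemma measurable_set1_rV {R : realType} m (x : 'rV[R]_m) : measurable [set x].
Proof.
rewrite (_ : [set x] = \bigcap_(i in [set: 'I_m])
    ((fun v : 'rV[R]_m => v ord0 i) @^-1` [set x ord0 i])); last first.
  apply/seteqP; split => [_ -> i _//|v h]; apply/rowP => i; exact: (h i I).
apply: fin_bigcap_measurable => // i _.
rewrite -[X in measurable X]setTI.
exact: (measurable_coord_rV i measurableT (measurable_set1 _)).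
Qed.

Lemma measurable_spatial {R : realType} m : measurable_fun setT (@spatial R m).
Proof.
apply: measurable_fun_rVP => i; under eq_fun do rewrite mxE.
exact: measurable_coord_rV.
Qed.

Local Open Scope ereal_scope.

(** * Atoms and void probabilities *)

Section atoms_of_point_processes.
Context {R : realType} {dT} {T : measurableType dT} (m : nat).
Variables (X : set 'rV[R]_m) (eta : R.-ker T ~> 'rV[R]_m).
Hypothesis heta : point_process X eta.

(** Translates counts into miss events: the atoms are exactly the points of the Dirac
    representation, since each of them contributes mass at least 1 to its singleton. *)
Lemma point_process_eq0 w (B : set 'rV[R]_m) : measurable B ->
  eta w B = 0 <-> atoms eta w `&` B = set0.
Proof.
move=> mB; have [I [x [Ix eE]]] := heta w.
have atomsE y : atoms eta w y <-> exists2 k, I k & x k = y.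
  rewrite /atoms/= eE; last exact: measurable_set1_rV.
  split=> [/eqP h|[k Ik <-]].
    apply: contrapT => hk; apply: h; apply: esum1 => k Ik.
    rewrite diracE memNset// => /= xy; apply: hk; by exists k.
  apply/eqP => h.
  have : \d_(x k) [set x k] <= \esum_(k' in I) \d_(x k') [set x k] :> \bar R.
    by apply: esum_ge; exists [set k]; [split => // _ ->|rewrite fsbig_set1].
  by rewrite h diracE mem_set// lee_fin ler10.
rewrite eE//; split=> [h|h].
  rewrite -subset0 => y [/atomsE [k Ik <-] By].
  have : \d_(x k) B <= \esum_(k' in I) \d_(x k') B :> \bar R.
    by apply: esum_ge; exists [set k]; [split => // _ ->|rewrite fsbig_set1].
  by rewrite h diracE mem_set// lee_fin ler10.
apply: esum1 => k Ik; rewrite diracE memNset// => Bx.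
have : (atoms eta w `&` B) (x k) by split => //; apply/atomsE; exists k.
by rewrite h.
Qed.

Lemma atoms_subset w : atoms eta w `<=` X.
Proof.
move=> y ay; have [I [x [Ix eE]]] := heta w.
apply: contrapT => Xy; move: ay; rewrite /atoms/= eE; last exact: measurable_set1_rV.
move/eqP; apply; apply: esum1 => k Ik; rewrite diracE memNset// => /= xy.
by apply: Xy; rewrite -xy; exact: Ix.
Qed.

End atoms_of_point_processes.

Section void_probabilities.
Context {R : realType}.

(** [exp (- r)] extended by its limit 0 at [+oo]; the value at [-oo] is a default. *)
Definition void_probability (r : \bar R) : \bar R :=
  if r is r'%:E then (expR (- r'))%:E else 0.

Lemma measurable_kernel_eq dT dE (T : measurableType dT) (E : measurableType dE)
    (eta : R.-ker T ~> E) (B : set E) (c : \bar R) :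
  measurable B -> measurable [set w | eta w B = c].
Proof.
move=> mB; have := measurable_kernel eta B mB measurableT.
move/(_ [set c] (emeasurable_set1 c)); rewrite setTI.
by congr measurable; apply/seteqP; split.
Qed.

Lemma poisson_process_void dT dE (T : measurableType dT) (E : measurableType dE)
    (P : probability T R) X (mu : set E -> \bar R) (eta : R.-ker T ~> E) B :
  poisson_process P X mu eta -> measurable B -> 0 <= mu B ->
  P [set w | eta w B = 0] = void_probability (mu B).
Proof.
move=> [_ Pfin Pinf _] mB; case E1 : (mu B) => [r| |//].
  rewrite lee_fin => r0.
  have := Pfin B mB; rewrite E1 ltry => /(_ isT 0%N) -> /=.
  rewrite /poisson_prob; case: ifPn => [r1|].
    by rewrite esum_set1 /poisson_pmf ?r1 ?fact0 ?expr0 ?invr1 ?mul1r//.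
  rewrite -leNgt => r1; have -> : r = 0%R by apply/eqP; rewrite eq_le r1.
  by rewrite diracE mem_set// oppr0 expR0.
move=> _ /=; have P1 := Pinf B mB E1.
have mB1 := measurable_kernel_eq eta +oo mB.
apply/eqP; rewrite eq_le measure_ge0 andbT.
have P0 : P (~` [set w | eta w B = +oo]) = 0.
  by rewrite probability_setC// P1 subee.
rewrite -[leRHS]P0; apply: le_measure; rewrite ?inE.
- exact: measurable_kernel_eq.
- exact: measurableC.
- by move=> w /= ->.
Qed.

End void_probabilities.

Lemma measurable_missType {R : realType} d dT (T : measurableType dT)
    (N : T -> @missType R d) :
  (forall A : set 'rV[R]_d, measurable A ->
    measurable [set w | N w `&` A = set0]) ->
  measurable_fun setT N.
Proof.
move=> mN; apply: (@measurability _ _ _ _ setT N (@miss_sets R d)) => //.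
by move=> _ [_ [A mA <-] <-]; rewrite setTI; exact: mN.
Qed.

Lemma eq_law_missType {R : realType} d dT (T : measurableType dT) (P : probability T R)
    (N : T -> @missType R d) dT' (T' : measurableType dT') (P' : probability T' R)
    (N' : T' -> @missType R d) :
  measurable_fun setT N -> measurable_fun setT N' ->
  (forall A : set 'rV[R]_d, measurable A ->
    P [set w | N w `&` A = set0] = P' [set w | N' w `&` A = set0]) ->
  forall H : set (@missType R d), measurable H -> P (N @^-1` H) = P' (N' @^-1` H).
Proof.
move=> mN mN' NN' H mH.
apply: (@measure_unique _ R (@missType R d) (@miss_sets R d) (fun=> setT) _ _ _ _
  (pushforward P N) (pushforward P' N')) => //.
- move=> _ _ [A mA <-] [B mB <-]; exists (A `|` B); first exact: measurableU.
  by apply/seteqP; split => S /=; rewrite setIUr setU_eq0.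
- by move=> _; exists set0 => //; apply/seteqP; split => S //= _; rewrite setI0.
- by rewrite bigcup_const//; exists 0%N.
- by move=> _ [A mA <-]; exact: NN'.
- move=> _; change (P (N @^-1` setT) < +oo).
  by rewrite preimage_setT probability_setT ltry.
Qed.

Local Close Scope ereal_scope.

(** * Boxes inside horoballs and their mass *)

Section boxes.
Context {R : realType} (d : nat).
Implicit Types (u v c : 'rV[R]_d).

Lemma enorm_le_l1norm v : enorm v <= l1norm v.
Proof.
rewrite -(@ler_pXn2r _ 2)// ?nnegrE ?enorm_ge0 ?l1norm_ge0// sqr_enorm expr2.
rewrite {2}/l1norm mulr_sumr; apply: ler_sum => i _.
rewrite -expr2 -real_normK ?num_real// expr2 ler_wpM2r// /l1norm (bigD1 i)//=.
by rewrite lerDl sumr_ge0.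
Qed.

(* The half-space condition that [star_map v] imposes on a dual point in the
   direction [u] says that [v] lies in the horoball through the origin centred
   at [u]; in this chart it is a paraboloid with axis [u]. *)
Definition horoball u : set 'rV[R]_d :=
  [set v | Num.sqrt (1 + dotv v v) < 1 + dotv u v].

(** Write [v = t u + w] and [b = <u,w>]. Squaring the condition leaves [|w|^2 < 2 t + 2 b + b^2],
    and [|b| <= |w| <= r]. *)
Lemma horoball_near_axis u v (t r : R) : dotv u u = 1 ->
  l1norm (v - t *: u) <= r -> r ^+ 2 + 2 * r < 2 * t -> horoball u v.
Proof.
move=> u1 vr rt.
have [w vE {}vr] : exists2 w, v = t *: u + w & l1norm w <= r.
  by exists (v - t *: u) => //; rewrite addrC subrK.
have wr : enorm w <= r by rewrite (le_trans (enorm_le_l1norm _)).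
have uE : enorm u = 1 by rewrite /enorm u1 sqrtr1.
have := dotv_le_enorm u w; rewrite uE mul1r => bw.
have w0 := enorm_ge0 w.
rewrite /horoball/= vE !(dotvDl, dotvDr, dotvZl, dotvZr) (dotvC w u) u1 -sqr_enorm.
move: (dotv u w) (enorm w) bw wr w0 => b e be er e0.
have [b1 b2] : - e <= b /\ b <= e by move: be; rewrite ler_norml => /andP.
have x0 : 0 < 1 + (t * 1 + b) by nra.
rewrite -[ltRHS]gtr0_norm// -sqrtr_sqr ltr_sqrt ?exprn_gt0//.
nra.
Qed.

Definition box c (h : R) : set 'rV[R]_d :=
  [set v | forall i, `|v ord0 i - c ord0 i| <= h].

Lemma measurable_box c h : measurable (box c h).
Proof.
rewrite (_ : box c h = \bigcap_(i in [set: 'I_d])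
    ((fun v : 'rV[R]_d => v ord0 i) @^-1` `[c ord0 i - h, c ord0 i + h]%classic)).
  apply: fin_bigcap_measurable => // i _; rewrite -[X in measurable X]setTI.
  exact: (measurable_coord_rV i measurableT (measurable_itv _)).
apply/seteqP; split => [v vb i _|v vb i].
  by rewrite /= in_itv/= -ler_distl; exact: vb.
by have := vb i I; rewrite /= in_itv/= -ler_distl.
Qed.

Lemma lebesgue_rV_centered_box c h : 0 <= h ->
  lebesgue_rV d (box c h) = ((2 * h) ^+ d)%:E.
Proof.
move=> h0.
rewrite (_ : box c h = [set v | forall i,
    `[c ord0 i - h, c ord0 i + h]%classic (v ord0 i)]).
  rewrite (@lebesgue_rV_box R d
      (fun i => `[c ord0 i - h, c ord0 i + h]%classic)); last first.
    by move=> i; exact: measurable_itv.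
  rewrite (eq_bigr (fun=> (2 * h)%:E)) => [|i _].
    by rewrite prodEFin big_const_ord iter_mulr_1.
  rewrite lebesgue_measure_itv/= lte_fin ltrD2l.
  have [h1|] := ltP (- h) h; first by rewrite -EFinB; congr EFin; ring.
  by move=> h1; congr EFin; lra.
by apply/seteqP; split => v vb i; have := vb i; rewrite /= in_itv/= -ler_distl.
Qed.

Lemma hyp_density_ge (b s : R) : 0 <= s -> s <= b -> (1 + b)^-1 <= hyp_density s.
Proof.
move=> s0 sb; rewrite /hyp_density lef_pV2 ?posrE ?sqrtr_gt0; [|nra|nra].
rewrite -[leRHS]ger0_norm; last by nra.
rewrite -sqrtr_sqr ler_sqrt; nra.
Qed.

Local Open Scope ereal_scope.

Lemma measurable_hyp_density_enorm :
  measurable_fun setT (fun v : 'rV[R]_d => (hyp_density (enorm v))%:E).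
Proof.
apply/measurable_EFinP.
exact: (measurableT_comp (continuous_measurable_fun continuous_hyp_density)
    (@measurable_enorm R _)).
Qed.

Lemma box_mass_ge c (h b : R) : (0 <= h)%R ->
  (forall v, box c h v -> (enorm v <= b)%R) ->
  ((1 + b)^-1 * (2 * h) ^+ d)%:E <=
  \int[lebesgue_rV d]_(v in box c h) (hyp_density (enorm v))%:E.
Proof.
move=> h0 vb.
have cb : box c h c by move=> i; rewrite subrr normr0.
have b0 : (0 <= b)%R by rewrite (le_trans (enorm_ge0 _) (vb _ cb)).
rewrite EFinM -(lebesgue_rV_centered_box c h0) -integral_cst;
  last exact: measurable_box.
apply: ge0_le_integral => //=; first exact: measurable_box.
- by move=> v _; rewrite lee_fin invr_ge0 addr_ge0.
- by apply: measurable_funTS; exact: measurable_hyp_density_enorm.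
- by move=> v /vb vb'; rewrite lee_fin hyp_density_ge// enorm_ge0.
Qed.

Lemma boxes_mass_ge (c : nat -> 'rV[R]_d) (h b : nat -> R) (a : R) J :
  (forall j, (0 <= h j)%R) -> (0 <= a)%R ->
  (forall j v, (j < J)%N -> box (c j) (h j) v -> (enorm v <= b j)%R) ->
  (forall j, (j < J)%N -> (a <= (1 + b j)^-1 * (2 * h j) ^+ d)%R) ->
  (forall i j, (i < j < J)%N -> box (c i) (h i) `&` box (c j) (h j) = set0) ->
  (J%:R * a)%:E <= \int[lebesgue_rV d]_
    (v in \big[setU/set0]_(j <- iota 0 J) box (c j) (h j))
    (hyp_density (enorm v))%:E.
Proof.
move=> h0 a0 hb ha hd.
rewrite ge0_integral_bigsetU//=; first last.
- by move=> v _; rewrite lee_fin hyp_density_ge0.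
- by apply: measurable_funTS; exact: measurable_hyp_density_enorm.
- apply/trivIsetP => i j; rewrite /= !mem_iota !add0n => iJ jJ.
  by rewrite neq_ltn => /orP[ij|ji]; [rewrite hd// ij|rewrite setIC hd// ji].
- exact: iota_uniq.
- by move=> j; exact: measurable_box.
have -> : (J%:R * a)%:E = \sum_(j <- iota 0 J) a%:E.
  by rewrite sumEFin big_const_seq count_predT size_iota iter_addr_0 mulr_natl.
rewrite !big_seq; apply: lee_sum => j; rewrite mem_iota add0n => /= jJ.
apply: le_trans (box_mass_ge _ (fun v => hb j v jJ)) => //.
by rewrite lee_fin ha.
Qed.

End boxes.

Local Open Scope ereal_scope.

(** The data of a union bound: a set [S i] is void with probability at most [expR (- a)], so [e]
    bounds the probability that some horoball through the origin contains no nucleus. *)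
Definition horoball_cover (R : realType) d (lambda e : R) :=
  exists (I : finType) (S : I -> set 'rV[R]_d) (a : R),
  [/\ forall i, measurable (S i),
      forall u, dotv u u = 1%R -> exists i, S i `<=` horoball u,
      forall i, a%:E <= lambda%:E *
        \int[lebesgue_rV d]_(v in S i) (hyp_density (enorm v))%:E &
      (#|I|%:R * expR (- a) <= e)%R].

(** * The dual almost surely lies in the open ball *)

Section boundedness.
Context {R : realType} (d : nat).

Lemma void_probability_le (a : R) (m : \bar R) : a%:E <= m ->
  void_probability m <= (expR (- a))%:E.
Proof.
case: m => [r| |//] /=; last by rewrite lee_fin expR_ge0.
by rewrite !lee_fin ler_expR lerN2.
Qed.

Context dT (T : measurableType dT) (P : probability T R)
  (eta : R.-ker T ~> 'rV[R]_d.+1) (lambda : R).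
Hypothesis heta : poisson_process P (hyperboloid d)
  (fun B => (lambda%:E * hyp_volume B)%E) eta.
Hypothesis lambda0 : (0 <= lambda)%R.

Lemma spatial_hyp_volume (V : set 'rV[R]_d) :
  hyp_volume (@spatial R d @^-1` V) =
  \int[lebesgue_rV d]_(v in V) (hyp_density (enorm v))%:E.
Proof.
rewrite hyp_volumeE; congr (\int[_]_(v in _) _).
by apply/seteqP; split => v /=; rewrite spatial_hyp_chart.
Qed.

Lemma measurable_spatial_preimage (V : set 'rV[R]_d) : measurable V ->
  measurable (@spatial R d @^-1` V).
Proof.
by move=> mV; rewrite -[X in measurable X]setTI; exact: measurable_spatial.
Qed.

(** A nucleus with spatial part [v] in the horoball of [x / |x|] gives
    [|x| (sqrt (1 + |v|^2) - 1) < <x,v>], while duality bounds [<x,v>] by [sqrt (1 + |v|^2) - 1]. *)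
Lemma star_atoms_bounded w (S : set 'rV[R]_d) x : dotv x x != 0%R ->
  measurable S -> eta w (@spatial R d @^-1` S) != 0 ->
  S `<=` horoball ((enorm x)^-1 *: x)%R ->
  convex_dual (star_atoms (atoms eta w)) x -> (enorm x < 1)%R.
Proof.
move=> x0 mS etaS Sx xd.
have [hp _ _ _] := heta.
have /set0P[z [az /Sx Sz]] : atoms eta w `&` @spatial R d @^-1` S != set0.
  apply/eqP => /(point_process_eq0 hp w (measurable_spatial_preimage mS)) h.
  by rewrite h eqxx in etaS.
set v := spatial z in Sz.
have v0 : v != 0%R.
  apply/eqP => v0; move: Sz; rewrite /horoball/= v0.
  have d0 (y : 'rV[R]_d) : dotv y 0 = 0%R.
    by rewrite /dotv big1// => i _; rewrite mxE mulr0.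
  by rewrite !d0 addr0 sqrtr1 ltxx.
have b0 : (0 < dotv v v)%R by rewrite lt0r dotvv_eq0 v0 dotv_ge0.
have s0 : (0 < Num.sqrt (1 + dotv v v) - 1)%R.
  by rewrite subr_gt0 -[ltLHS]sqrtr1 ltr_sqrt ?ltrDl// ltr_pwDl// ltW.
have nx : (0 < enorm x)%R by rewrite enorm_gt0 -dotvv_eq0.
have : (dotv x (star_map v) <= 1)%R by apply: xd; exists z.
rewrite dotvZr mulrC ler_pdivrMr// mul1r.
move: Sz; rewrite /horoball/= dotvZl -ltrBlDl ltr_pdivlMl// => h1 h2.
rewrite -(@ltr_pM2r _ (Num.sqrt (1 + dotv v v) - 1)%R)// mul1r.
exact: lt_le_trans h1 h2.
Qed.

Lemma ae_dual_bounded :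
  (forall e : R, (0 < e)%R -> horoball_cover d lambda e) ->
  {ae P, forall w, convex_dual (star_atoms (atoms eta w)) `<=` @open_unit_ball R d}.
Proof.
move=> hcov.
have mN V : measurable V -> measurable [set w | eta w (@spatial R d @^-1` V) = 0].
  by move=> mV; apply: measurable_kernel_eq; exact: measurable_spatial_preimage.
have PN V (a : R) : measurable V ->
    a%:E <= lambda%:E * \int[lebesgue_rV d]_(v in V) (hyp_density (enorm v))%:E ->
    P [set w | eta w (@spatial R d @^-1` V) = 0] <= (expR (- a))%:E.
  move=> mV aV; rewrite (poisson_process_void heta).
  - by rewrite spatial_hyp_volume; exact: void_probability_le.
  - exact: measurable_spatial_preimage.
  - rewrite mule_ge0 ?lee_fin// hyp_volumeE; apply: integral_ge0 => v _.
    by rewrite lee_fin hyp_density_ge0.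
(* Not shown to be measurable; it is caught in events [A k] of probability at most [1 / (k + 1)],
   whose intersection is the required null set. *)
pose bad := [set w |
  ~ (convex_dual (star_atoms (atoms eta w)) `<=` @open_unit_ball R d)].
have hA (k : nat) :
    exists A : set T, [/\ measurable A, P A <= (k.+1%:R^-1)%:E & bad `<=` A].
  have [|I [S [a [mS Su aS Ie]]]] := hcov k.+1%:R^-1%R; first by rewrite invr_gt0.
  exists (\big[setU/set0]_(i : I) [set w | eta w (@spatial R d @^-1` S i) = 0]); split.
  - by apply: bigsetU_measurable => i _; exact: mN.
  - apply: (@le_trans _ _ (\sum_(i : I) P [set w | eta w (@spatial R d @^-1` S i) = 0])).
      set U := \big[setU/set0]_(i : I) _.
      (* The induction also carries the measurability of partial unions, which [measureU2]
         requires. *)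
      suff : measurable U /\ P U <=
        \sum_(i : I) P [set w | eta w (@spatial R d @^-1` S i) = 0] by case.
      rewrite /U.
      elim/big_rec2: _ => [|i s B _ [mB Bs]]; first by rewrite measure0.
      split; first by apply: measurableU => //; exact: mN.
      apply: (@le_trans _ _
        (P [set w | eta w (@spatial R d @^-1` S i) = 0] + P B)); last exact: leeD.
      by apply: measureU2 => //; exact: mN.
    apply: (@le_trans _ _ (\sum_(i : I) (expR (- a))%:E)).
      by apply: lee_sum => i _; exact: PN.
    by rewrite sumEFin lee_fin (le_trans _ Ie)// sumr_const mulr_natl.
  - move=> w hw; apply: contrapT => hU; apply: hw => x xd.
    have [x1|x1] := ltP (enorm x) 1%R; first exact: x1.
    have x0 : dotv x x != 0%R by rewrite -sqr_enorm sqrf_eq0 gt_eqF// (lt_le_trans ltr01).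
    have [|i Si] := Su ((enorm x)^-1 *: x)%R.
      rewrite dotvZl dotvZr -sqr_enorm; field.
      by rewrite gt_eqF// (lt_le_trans ltr01).
    apply: (star_atoms_bounded x0 (mS i) _ Si xd).
    apply/eqP => ei; apply: hU; rewrite (bigD1 i)//=; by left.
pose A k := projT1 (cid (hA k)).
have AP k : [/\ measurable (A k), P (A k) <= (k.+1%:R^-1)%:E & bad `<=` A k].
  exact: (projT2 (cid (hA k))).
exists (\bigcap_k A k); split.
- by apply: bigcapT_measurable => k; have [] := AP k.
- apply/eqP; rewrite eq_le measure_ge0 andbT; apply/lee_addgt0Pr => e e0.
  have [k _ /(_ k (leqnn k)) ke] := near_infty_natSinv_lt (PosNum e0).
  rewrite add0e (@le_trans _ _ (P (A k)))//.
    apply: le_measure; rewrite ?inE; last exact: bigcap_inf.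
      by apply: bigcapT_measurable => j; have [] := AP j.
    by have [] := AP k.
  have [_ Ak _] := AP k; rewrite (le_trans Ak)// lee_fin; exact: ltW.
- by move=> w bw k _; have [_ _ ] := AP k; apply.
Qed.

End boundedness.

Local Close Scope ereal_scope.

(** * Horoball covers in dimension one and in higher dimensions *)

Lemma expRN_le_inv {R : realType} (x : R) : 0 < x -> expR (- x) <= x^-1.
Proof.
move=> x0; rewrite expRN lef_pV2 ?posrE ?expR_gt0//.
by rewrite (le_trans _ (expR_ge1Dx x))// lerDr.
Qed.

Lemma exprM_exprS_inv {R : fieldType} (a b k : R) n : k != 0 ->
  (a * k) ^+ n * (b * k^-1) ^+ n.+1 = a ^+ n * b ^+ n.+1 / k.
Proof.
move=> k0; rewrite (exprMn _ a) (exprMn _ b) (exprS k^-1) mulrACA; congr (_ * _).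
by rewrite mulrCA -exprMn mulfV// expr1n mulr1.
Qed.

Lemma exists_nat_inv_le {R : realType} (K e : R) : 0 < e ->
  exists2 k : nat, (0 < k)%N & K / k%:R <= e.
Proof.
move=> e0; exists (Num.truncn (K / e)).+1 => //.
rewrite ler_pdivrMr// mulrC -ler_pdivrMr//; exact/ltW/truncnS_gt.
Qed.

(** On the line the two horoballs are half-lines of logarithmically infinite mass. The dyadic
    interval from [5/4 * 2^j] to [7/4 * 2^j] has length [2^j / 2] and density at least
    [1 / (3 * 2^j)], hence mass at least [1/6]. *)
Lemma horoball_cover1 {R : realType} (lambda e : R) : 0 < lambda -> 0 < e ->
  horoball_cover 1 lambda e.
Proof.
move=> l0 e0.
(* With [J] intervals on each side, [2 * expR (- x) <= 2 / x] for [x = lambda * J / 6] gives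
   [12 / (lambda * J)]. *)
have [J J0 Je] := exists_nat_inv_le (12 / lambda) e0.
pose s (b : bool) : R := if b then 1 else -1.
have s2 b : s b * s b = 1 by case: b; rewrite /s ?mulr1// mulrNN mulr1.
pose p (j : nat) : R := 2 ^+ j.
have p1 j : 1 <= p j by rewrite exprn_ege1// ler1n.
pose c b j : 'rV[R]_1 := const_mx (s b * (3 / 2 * p j)).
pose h j := p j / 4.
have boxE b j v : box (c b j) (h j) v ->
    5 / 4 * p j <= s b * v ord0 ord0 /\ s b * v ord0 ord0 <= 7 / 4 * p j.
  move=> /(_ ord0); rewrite mxE ler_norml /h => /andP[h1 h2].
  by move: h1 h2; have := p1 j; rewrite /s; case: b => h0 h1 h2; split; lra.
exists bool, (fun b => \big[setU/set0]_(j <- iota 0 J) box (c b j) (h j)),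
  (lambda * (J%:R * 6^-1)); split.
- by move=> b; apply: bigsetU_measurable => j _; exact: measurable_box.
- move=> u u1.
  have /orP[/eqP uE|/eqP uE] : (u ord0 ord0 == 1) || (u ord0 ord0 == -1).
  + by rewrite -sqrf_eq1 expr2 -u1 /dotv big_ord1.
  + exists true.
    rewrite -bigcup_seq => v [j _ /boxE[v1 v2]].
    apply: (@horoball_near_axis _ _ u v (v ord0 ord0) 0) => //.
      rewrite (_ : v - _ = 0) ?/l1norm ?big_ord1 ?mxE ?normr0//.
      by apply/rowP => i; have -> : i = ord0
        by [rewrite ord1; exact: val_inj]; rewrite !mxE uE mulr1 subrr.
    by move: v1; rewrite /s; have := p1 j; nra.
  + exists false.
    rewrite -bigcup_seq => v [j _ /boxE[v1 v2]].
    apply: (@horoball_near_axis _ _ u v (- v ord0 ord0) 0) => //.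
      rewrite (_ : v - _ = 0) ?/l1norm ?big_ord1 ?mxE ?normr0//.
      by apply/rowP => i; have -> : i = ord0
        by [rewrite ord1; exact: val_inj]; rewrite !mxE uE mulrNN mulr1 subrr.
    by move: v1; rewrite /s; have := p1 j; nra.
- move=> b; rewrite EFinM; apply: lee_wpmul2l; first by rewrite lee_fin ltW.
  apply: (@boxes_mass_ge R 1 (c b) h (fun j => 2 * p j) 6^-1 J) => //=.
  + by move=> j; rewrite /h divr_ge0// (le_trans ler01).
  + move=> j v _ /boxE[v1 v2]; rewrite (le_trans (enorm_le_l1norm _))//.
    rewrite /l1norm big_ord1 ler_norml; have := p1 j; move: v1 v2; rewrite /s.
    by case: b => v1 v2 v3; apply/andP; split; lra.
  + move=> j _; rewrite expr1 /h mulrC ler_pdivlMr ?ltr_wpDl//; have := p1 j; lra.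
  + move=> i j /andP[ij _]; rewrite -subset0 => v [/boxE[v1 v2] /boxE[v3 v4]].
    have : 2 * p i <= p j by rewrite /p -exprS ler_weXn2l// ler1n.
    have := p1 i => h1 h2; suff : False by [].
    by lra.
- rewrite card_bool.
  apply: le_trans Je; rewrite (le_trans (ler_wpM2l _ (expRN_le_inv _)))//.
    by rewrite !mulr_gt0// ltr0n.
  rewrite le_eqVlt; apply/orP; left; apply/eqP; field.
  by rewrite (gt_eqF l0) pnatr_eq0 -lt0n J0.
Qed.

(* The directions are those of a grid of mesh [1 / M], and the horoball of each
   contains [k] disjoint boxes of side about [k] centred on its axis, between
   the heights [k ^ 2] and [2 k ^ 2]. *)
Section cover_ge2.
Context {R : realType} (m : nat).
Notation d := m.+2.
Notation D := (d%:R : R).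
Variable k : nat.
Hypothesis k0 : (0 < k)%N.

(** The mesh is tuned to the boxes: up to height [2 k^2], replacing a direction by its grid
    neighbour moves each coordinate by at most [2 k^2 / M = h]. With the box half-side [h] this
    gives an l1 deviation of at most [2 h d = k / 4], which the paraboloid tolerates from height
    [k^2] on. *)
Let M := (16 * d * k)%N.
Let h : R := k%:R / (8 * D).
Let t (j : nat) : R := k%:R ^+ 2 + j%:R * k%:R.
Let q (f : {ffun 'I_d -> 'I_(2 * M).+1}) : 'rV[R]_d :=
  \row_i (((f i)%:R - M%:R) / M%:R).

Let kR : 1 <= k%:R :> R. Proof. by rewrite ler1n. Qed.
Let DR : 2 <= D. Proof. by rewrite ler_nat. Qed.
Let ME : M%:R = 16 * D * k%:R :> R. Proof. by rewrite /M !natrM. Qed.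
Let M0 : 0 < M%:R :> R. Proof. by rewrite ME !mulr_gt0//; have := DR; have := kR; lra. Qed.

Let t_le j : (j < k)%N -> t j <= 2 * k%:R ^+ 2.
Proof.
move=> jk; have : j%:R <= k%:R :> R by rewrite ler_nat ltnW.
by rewrite /t; have := kR; nra.
Qed.

Let t_ge j : k%:R ^+ 2 <= t j.
Proof. by rewrite /t lerDl mulr_ge0. Qed.

Let h_ge0 : 0 <= h.
Proof. by rewrite divr_ge0// mulr_ge0. Qed.

Let q_le1 f i : `|q f ord0 i| <= 1.
Proof.
rewrite mxE ler_norml; have : (f i <= 2 * M)%N by rewrite -ltnS.
rewrite -(ler_nat R) natrM => h1; have h2 : 0 <= (f i)%:R :> R by [].
by rewrite ler_pdivlMr// ler_pdivrMr//; apply/andP; split; lra.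
Qed.

Let near_q (u : 'rV[R]_d) : dotv u u = 1 ->
  exists f, forall i, `|u ord0 i - q f ord0 i| <= M%:R^-1.
Proof.
move=> u1.
have ui i : `|u ord0 i| <= 1.
  rewrite -(@ler_pXn2r _ 2)// ?nnegrE// real_normK ?num_real// expr1n -u1.
  by rewrite /dotv (bigD1 i)//= expr2 lerDl sumr_ge0// => j _; rewrite -expr2 sqr_ge0.
have fl i : { n : 'I_(2 * M).+1 |
    (n%:R - M%:R) <= u ord0 i * M%:R :> R /\ u ord0 i * M%:R <= (n%:R - M%:R) + 1}.
  have := ui i; rewrite ler_norml => /andP[u2 u3].
  have a0 : 0 <= (u ord0 i + 1) * M%:R by rewrite mulr_ge0 ?(ltW M0)//; lra.
  have a1 : (Num.truncn ((u ord0 i + 1) * M%:R) < (2 * M).+1)%N.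
    rewrite ltnS truncn_le_nat -natr1 natrM.
    by rewrite ltr_pwDr// ler_wpM2r ?(ltW M0)//; lra.
  exists (Ordinal a1) => /=.
  have := truncn_itv a0 => /andP[h1]; rewrite -natr1 => h2; split; lra.
exists [ffun i => projT1 (cid (ex_intro _ _ (svalP (fl i))))] => i.
rewrite mxE ffunE; case: cid => n [n1 n2] /=.
rewrite (_ : _ - _ = (u ord0 i * M%:R - (n%:R - M%:R)) / M%:R); last first.
  by field; rewrite gt_eqF.
rewrite normrM (ger0_norm (_ : 0 <= M%:R^-1)) ?invr_ge0//.
by rewrite ger_pMl ?invr_gt0// ler_norml; apply/andP; split; lra.
Qed.

(** The grid contains points too close to 0, along which the boxes would overlap. A coordinate above
    [1 / (4 D)] separates consecutive centres by more than the box side [2 h = k / (4 D)]. *)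
Let good f := [exists i, (4 * D)^-1 < `|q f ord0 i| ].

(** A unit vector has a coordinate above [1 / (2 D)], since otherwise its squared norm would be at
    most [1 / (4 D)]; rounding costs at most [1 / (16 D)]. *)
Let good_q (u : 'rV[R]_d) f : dotv u u = 1 ->
  (forall i, `|u ord0 i - q f ord0 i| <= M%:R^-1) -> good f.
Proof.
move=> u1 uq; apply/existsP.
have [i ui] : exists i, (2 * D)^-1 < `|u ord0 i|.
  apply: contrapT => hn.
  have ui i : u ord0 i * u ord0 i <= (2 * D)^-1 ^+ 2.
    rewrite -expr2 -real_normK ?num_real// ler_pXn2r// ?nnegrE// ?invr_ge0 ?mulr_ge0//.
    by rewrite leNgt; apply/negP => h1; apply: hn; exists i.
  have : dotv u u <= \sum_(i < d) (2 * D)^-1 ^+ 2 by apply: ler_sum => i _.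
  rewrite u1 sumr_const card_ord -[X in _ <= X]mulr_natr invfM => h1.
  have Dx : D^-1 * D = 1 by rewrite mulVf.
  have x1 : D^-1 <= 1 by rewrite invf_le1// ler1n.
  have aux (x y : R) : (2^-1 * x) ^+ 2 * y = x * y * x / 4 by field.
  by move: h1 x1; rewrite aux Dx mul1r; move: D^-1 => x; lra.
exists i; have := uq i; have := lerB_dist (u ord0 i) (q f ord0 i).
have M4 : M%:R^-1 <= (16 * D)^-1.
  by rewrite lef_pV2 ?posrE ?mulr_gt0// ME ler_peMr// mulr_ge0.
move: ui M4; rewrite !invfM; have : 0 < D^-1 by rewrite invr_gt0.
move: D^-1 M%:R^-1 => x y; lra.
Qed.

Let S f := \big[setU/set0]_(j <- iota 0 k) box (t j *: q f) h.

Let D0 : D != 0. Proof. by rewrite pnatr_eq0. Qed.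

Let hD : D * (2 * h) = k%:R / 4.
Proof. by rewrite /h; move: D D0 => x x0; field. Qed.

Let S_horoball (u : 'rV[R]_d) f : dotv u u = 1 ->
  (forall i, `|u ord0 i - q f ord0 i| <= M%:R^-1) -> S f `<=` horoball u.
Proof.
move=> u1 uq; rewrite /S -bigcup_seq => v [j /=].
rewrite mem_iota add0n => /= jk vb.
have tj0 : 0 <= t j by rewrite (le_trans _ (t_ge j))// exprn_ge0.
apply: (@horoball_near_axis _ _ u v (t j) (k%:R / 4)) => //.
  rewrite -hD /l1norm mulr_natl -[d in X in _ <= X]card_ord -sumr_const.
  apply: ler_sum => i _; rewrite !mxE.
  have h1 : t j * M%:R^-1 <= h.
    rewrite ler_pdivrMr// (le_trans (t_le jk))// ME /h.
    by rewrite le_eqVlt; apply/orP; left; apply/eqP; move: D D0 => x x0; field.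
  have h2 := vb i; rewrite mxE in h2.
  have h3 : `|t j * q f ord0 i - t j * u ord0 i| <= h.
    rewrite -mulrBr normrM ger0_norm// (le_trans _ h1)// ler_wpM2l//.
    by rewrite distrC.
  rewrite (le_trans (ler_distD (t j * q f ord0 i) _ _))//.
  by rewrite mulr_natl mulr2n lerD.
have := t_ge j; have := kR; nra.
Qed.

Let S_mass f : good f ->
  ((k%:R * ((1 + 3 * D * k%:R ^+ 2)^-1 * (2 * h) ^+ d))%:E <=
  \int[lebesgue_rV d]_(v in S f) (hyp_density (enorm v))%:E)%E.
Proof.
move=> /existsP[i0 qi0].
apply: (@boxes_mass_ge R d (fun j => t j *: q f) (fun=> h) (fun=> 3 * D * k%:R ^+ 2)) => //.
- apply: mulr_ge0; last by rewrite exprn_ge0// mulr_ge0.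
  by rewrite invr_ge0 addr_ge0// !mulr_ge0// exprn_ge0.
(* Each coordinate is at most [2 k^2 + h <= 3 k^2] in absolute value. *)
- move=> j v jk vb; rewrite (le_trans (enorm_le_l1norm _))//.
  have -> : 3 * D * k%:R ^+ 2 = \sum_(i < d) (3 * k%:R ^+ 2).
    by rewrite sumr_const card_ord -[RHS]mulr_natr mulrAC.
  apply: ler_sum => i _.
  have := vb i; rewrite mxE => h1.
  have h2 : `|t j * q f ord0 i| <= 2 * k%:R ^+ 2.
    rewrite normrM ger0_norm; last by rewrite (le_trans _ (t_ge j))// exprn_ge0.
    by rewrite (le_trans _ (t_le jk))// ler_piMr// (le_trans _ (t_ge j))// exprn_ge0.
  have h3 : h <= k%:R ^+ 2.
    rewrite ler_pdivrMr ?mulr_gt0//; have := kR; have := DR; nra.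
  have := lerB_dist (v ord0 i) (t j * q f ord0 i); lra.
- move=> i j /andP[ij jk]; rewrite -subset0 => v [/(_ i0) h1 /(_ i0) h2].
  rewrite mxE in h1; rewrite mxE in h2.
  have h3 : `|t j * q f ord0 i0 - t i * q f ord0 i0| <= 2 * h.
    rewrite (le_trans (ler_distD (v ord0 i0) _ _))// mulr_natl mulr2n lerD//.
    by rewrite distrC.
  have ij1 : (1 : R) <= j%:R - i%:R by rewrite lerBrDr addrC natr1 ler_nat.
  move: h3; rewrite -mulrBl normrM /t opprD addrACA subrr add0r -mulrBl.
  rewrite ger0_norm ?mulr_ge0//; last by rewrite (le_trans ler01).
  have h4 : 2 * h = k%:R * (4 * D)^-1 by rewrite /h; move: D D0 => x x0; field.
  rewrite h4 leNgt => /negP[].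
  rewrite (@lt_le_trans _ _ (k%:R * `|q f ord0 i0|))//.
    by rewrite ltr_pM2l ?ltr0n// qi0.
  by rewrite ler_wpM2r// ler_peMl.
Qed.

(** Here [d >= 2] enters: [1 + 3 D k^2 <= 4 D k^2 <= 4 D k^d], so each box keeps a mass bounded
    below independently of [k]. *)
Let mass_ge : ((4 * D) ^+ d.+1)^-1 <= (1 + 3 * D * k%:R ^+ 2)^-1 * (2 * h) ^+ d.
Proof.
have h4 : 2 * h = k%:R / (4 * D) by rewrite /h; move: D D0 => x x0; field.
rewrite h4 expr_div_n exprS invfM mulrA ler_pM2r ?invr_gt0 ?exprn_gt0 ?mulr_gt0//.
have k2 : k%:R ^+ 2 <= k%:R ^+ d :> R by rewrite ler_weXn2l.
have k3 : 1 <= k%:R ^+ 2 :> R by rewrite exprn_ege1.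
have p : 0 < 1 + 3 * D * k%:R ^+ 2 :> R.
  by rewrite ltr_pwDl// !mulr_ge0// exprn_ge0.
rewrite ler_pdivlMl// ler_pdivrMr ?mulr_gt0//.
have := DR; move: (k%:R ^+ d) k2 => y k2; nra.
Qed.

Lemma horoball_cover_scale (lambda : R) : 0 <= lambda ->
  horoball_cover d lambda ((33 * D * k%:R) ^+ d *
    expR (- (lambda * (k%:R / (4 * D) ^+ d.+1)))).
Proof.
move=> l0; exists {f | good f}, (fun f => S (val f)),
  (lambda * (k%:R * ((1 + 3 * D * k%:R ^+ 2)^-1 * (2 * h) ^+ d))); split.
- by move=> f; apply: bigsetU_measurable => j _; exact: measurable_box.
- move=> u u1; have [f uf] := near_q u1.
  by exists (exist _ f (good_q u1 uf)); exact: S_horoball.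
- move=> f; rewrite EFinM; apply: lee_wpmul2l; first by rewrite lee_fin.
  exact/S_mass/(valP f).
- apply: ler_pM; [by []|exact: expR_ge0| |].
    rewrite card_sig (le_trans (_ : _ <= #|{ffun 'I_d -> 'I_(2 * M).+1}|%:R))//.
      by rewrite ler_nat max_card.
    (* Each coordinate has [2 M + 1 = 32 d k + 1 <= 33 d k] grid values. *)
    rewrite card_ffun !card_ord natrX ler_pXn2r// ?nnegrE//.
    rewrite -!natrM ler_nat /M -addn1; have := k0; lia.
  by rewrite ler_expR lerN2 ler_wpM2l// ler_wpM2l.
Qed.

End cover_ge2.

(** To beat the [k^d] directions, [expR (- (c * k))] is split as the power [d + 1] of [expR (- y)]
    with [y = c * k / (d + 1)]; bounding [expR (- y)] by [y^-1] leaves a constant divided by [k]. *)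
Lemma horoball_cover_ge2 {R : realType} m (lambda e : R) : 0 < lambda -> 0 < e ->
  horoball_cover m.+2 lambda e.
Proof.
move=> l0 e0; set d := m.+2.
pose c := lambda / (4 * d%:R) ^+ d.+1.
have c0 : 0 < c by rewrite divr_gt0// exprn_gt0// mulr_gt0.
have [k k0 ke] := exists_nat_inv_le ((33 * d%:R) ^+ d * (d.+1%:R / c) ^+ d.+1) e0.
have [I [S [a [mS Su aS Ie]]]] := horoball_cover_scale m k0 (ltW l0).
exists I, S, a; split => //; apply: (le_trans Ie); apply: le_trans ke.
have k1 : 0 < k%:R :> R by rewrite ltr0n.
have -> : lambda * (k%:R / (4 * d%:R) ^+ d.+1) = c * k%:R / d.+1%:R * d.+1%:R.
  by rewrite mulfVK// /c; ring.
rewrite -mulNr expRM_natr.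
set y := c * k%:R / d.+1%:R.
have y0 : 0 < y by rewrite /y divr_gt0// mulr_gt0.
apply: (@le_trans _ _ ((33 * d%:R * k%:R) ^+ d * y^-1 ^+ d.+1)).
  rewrite ler_wpM2l ?exprn_ge0 ?mulr_ge0//.
  by rewrite ler_pXn2r ?nnegrE ?expR_ge0 ?invr_ge0 ?(ltW y0)// expRN_le_inv.
have -> : y^-1 = d.+1%:R / c * k%:R^-1 by rewrite /y invf_div invfM mulrA.
by rewrite exprM_exprS_inv// gt_eqF.
Qed.

(** * Finiteness and positivity of the Gamma integral *)

Section gamma.
Context {R : realType}.
Notation mu := (@lebesgue_measure R).

Let is_derive_2sqrt (t : R) : 0 < t ->
  is_derive t 1 (fun s => 2 * Num.sqrt s) (Num.sqrt t)^-1.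
Proof.
move=> t0; have h := is_derive1_sqrt t0.
apply: is_derive_eq.
rewrite /GRing.scale/=. by field; rewrite gt_eqF// sqrtr_gt0.
Qed.

Let continuous_inv_sqrt (t : R) : 0 < t ->
  {for t, continuous (fun s : R => (Num.sqrt s)^-1)}.
Proof.
move=> t0; apply: cvgV; first by rewrite gt_eqF// sqrtr_gt0.
exact: sqrt_continuous.
Qed.

Lemma measurable_gamma_integrand (x : R) :
  measurable_fun setT (fun t : R => t `^ (x - 1) * expR (- t)).
Proof.
apply: measurable_funM; first exact: measurable_powR.
apply: measurableT_comp => //.
Qed.

Local Open Scope ereal_scope.

Lemma measurable_inv_sqrt :
  measurable_fun setT (fun t : R => ((Num.sqrt t)^-1)%:E).
Proof.
apply/measurable_EFinP; apply: (measurableT_comp measurable_invr).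
by apply: continuous_measurable_fun; exact: sqrt_continuous.
Qed.

Lemma integral_inv_sqrt_le :
  \int[mu]_(t in `]0%R, 1%R]) ((Num.sqrt t)^-1)%:E <= 2%:E.
Proof.
(* Segments away from 0, where the primitive [2 * sqrt t] is differentiable, followed by monotone
   convergence. The shift by two keeps the left end strictly below 1. *)
pose F (k : nat) : set R := `[k.+2%:R^-1%R, 1%R]%classic.
have k1 k : (k.+2%:R^-1 < 1 :> R)%R by rewrite invf_lt1// ltr1n.
have FE : `]0%R, 1%R]%classic = \bigcup_k F k.
  apply/seteqP; split => [t|t [k _]]; rewrite /F /= !in_itv/=.
    move=> /andP[t0 t1].
    have [k _ /(_ k (leqnn k)) kt] := near_infty_natSinv_lt (PosNum t0).
    exists k => //=; rewrite in_itv/= t1 andbT (le_trans _ (ltW kt))//.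
    by rewrite lef_pV2 ?posrE// ler_nat.
  by move=> /andP[kt ->]; rewrite andbT (lt_le_trans _ kt)// invr_gt0.
have mS := measurable_inv_sqrt.
have F0 i t : F i t -> 0 <= ((Num.sqrt t)^-1)%:E by rewrite lee_fin invr_ge0 sqrtr_ge0.
have ndF : nondecreasing_seq F.
  move=> i j ij; rewrite subsetEset => t; rewrite /F/= !in_itv/= => /andP[+ ->].
  by rewrite andbT; apply: le_trans; rewrite lef_pV2 ?posrE// ler_nat.
rewrite FE.
have mSF (i : nat) : @measurable_fun _ _ (measurableTypeR R) _ (F i)
    (fun t => ((Num.sqrt t)^-1)%:E).
  exact (measurable_funTS mS).
have := @ge0_nondecreasing_set_cvg_integral _ (measurableTypeR R) R F
  (fun t => ((Num.sqrt t)^-1)%:E) mu ndF (fun i => measurable_itv _) mSF F0.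
move=> h; rewrite -(cvg_lim _ h)//; apply: lime_le; first exact: cvgP h.
apply: nearW => k.
rewrite (@continuous_FTC2 R _ (fun s => 2 * Num.sqrt s)%R)//.
- rewrite sqrtr1 mulr1 -EFinB lee_fin gerBl mulr_ge0// sqrtr_ge0.
- apply: continuous_in_subspaceT => t; rewrite inE/= in_itv/= => /andP[kt _].
  by apply: continuous_inv_sqrt; rewrite (lt_le_trans _ kt)// invr_gt0.
- have d (t : R) : (0 < t)%R -> derivable (fun s => 2 * Num.sqrt s)%R t 1.
    by move=> t0; exact: (@ex_derive _ _ _ _ _ _ _ (is_derive_2sqrt t0)).
  have c (t : R) : (0 < t)%R -> (2 * Num.sqrt s)%R @[s --> t] --> (2 * Num.sqrt t)%R.
    by move=> t0; apply: cvgM; [exact: cvg_cst|exact: sqrt_continuous].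
  split.
  + move=> t; rewrite in_itv/= => /andP[kt _]; apply: d.
    by rewrite (lt_trans _ kt)// invr_gt0.
  + by apply: cvg_at_right_filter; apply: c; rewrite invr_gt0.
  + by apply: cvg_at_left_filter; exact: c.
- move=> t; rewrite in_itv/= => /andP[kt _]; rewrite derive1E.
  apply: (@derive_val _ _ _ _ _ _ _ (is_derive_2sqrt _)).
  by rewrite (lt_trans _ kt)// invr_gt0.
Qed.

(** The threshold is the smallest argument that occurs, [d / 2] for [d = 1]. Below 1 the integrand
    is at most [1 / sqrt t]; above 1 it is dominated by a multiple of the exponential density of
    rate [1/2]. *)
Lemma gamma_integral_fin (x : R) : (2^-1 <= x)%R ->
  \int[mu]_(t in `]0%R, +oo[) (t `^ (x - 1) * expR (- t))%:E < +oo.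
Proof.
move=> x2; pose f (t : R) := (t `^ (x - 1) * expR (- t))%R.
have f0 t : 0 <= (f t)%:E by rewrite lee_fin mulr_ge0 ?powR_ge0// expR_ge0.
have mf : measurable_fun setT (EFin \o f).
  by apply/measurable_EFinP; exact: measurable_gamma_integrand.
have -> : `]0%R, +oo[%classic = `]0%R, 1%R]%classic `|` `]1%R, +oo[%classic :> set R.
  by apply: itv_bndbnd_setU; rewrite ?bnd_simp ?ler01.
rewrite ge0_integral_setU//=.
- apply: lte_add_pinfty.
    apply: (@le_lt_trans _ _ 2%:E); last exact: ltry.
    apply: le_trans integral_inv_sqrt_le; apply: ge0_le_integral => //=.
    + by move=> t _; exact: f0.
    + exact: measurable_funTS mf.
    + by apply: measurable_funTS; exact: measurable_inv_sqrt.
    + move=> t; rewrite in_itv/= => /andP[t0 t1]; rewrite lee_fin /f.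
      rewrite -[leRHS]mulr1 ler_pM ?powR_ge0 ?expR_ge0//; last first.
        by rewrite -expR0 ler_expR oppr_le0 ltW.
      rewrite -powR12_sqrt ?(ltW t0)// -powRN ger_powR ?t0//; lra.
  pose n := (Num.truncn x).+1.
  (* Raising [t / (2 n) <= expR (t / (2 n))] to the power [n] gives [t ^+ n <= C * expR (t / 2)]. *)
  pose C : R := ((2 * n%:R) ^+ n)%R.
  have C0 : (0 <= C)%R by rewrite exprn_ge0// mulr_ge0.
  have mpdf : measurable_fun setT (fun t : R => (exponential_pdf 2^-1 t)%:E).
    by apply/measurable_EFinP; exact: measurable_exponential_pdf.
  have pdf0 (t : R) : 0 <= (exponential_pdf 2^-1 t)%:E.
    by rewrite lee_fin exponential_pdf_ge0// invr_ge0.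
  apply: (@le_lt_trans _ _ (\int[mu]_t ((2 * C)%:E * (exponential_pdf 2^-1 t)%:E))).
    apply: (@le_trans _ _ (\int[mu]_(t in `]1%R, +oo[)
        ((2 * C)%:E * (exponential_pdf 2^-1 t)%:E))); last first.
      apply: ge0_subset_integral => //=.
      - exact: emeasurable_funM.
      - by move=> t _; rewrite mule_ge0// lee_fin mulr_ge0.
    apply: ge0_le_integral => //=.
    + by move=> t _; exact: f0.
    + exact: measurable_funTS mf.
    + by apply: measurable_funTS; exact: emeasurable_funM.
    + move=> t; rewrite in_itv/= andbT => t1; rewrite -EFinM lee_fin.
      have t0 : (0 < t)%R := lt_trans ltr01 t1.
      rewrite exponential_pdfE ?(ltW t0)//=.
      have -> : (2 * C * (2^-1 * expR (- 2^-1 * t)) = C * expR (- 2^-1 * t))%R.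
        by field.
      have -> : (- t = - 2^-1 * t + - (2^-1 * t))%R by field.
      rewrite expRD mulrCA [leRHS]mulrC ler_pM2l ?expR_gt0//.
      rewrite expRN ler_pdivrMr ?expR_gt0//.
      have n0 : (0 < n%:R :> R)%R by rewrite ltr0n.
      apply: (@le_trans _ _ (t ^+ n)%R).
        rewrite -powR_mulrn ?(ltW t0)// ler_powR// ?(ltW t1)//.
        have : (x < n%:R)%R by exact: truncnS_gt.
        lra.
      have -> : (2^-1 * t = t / (2 * n%:R) * n%:R)%R by field; rewrite gt_eqF.
      rewrite expRM_natr /C -exprMn ler_pXn2r// ?nnegrE ?mulr_ge0 ?expR_ge0 ?(ltW t0)//.
      have := expR_ge1Dx (t / (2 * n%:R)).
      have t2 : (t = 2 * n%:R * (t / (2 * n%:R)))%R by field; rewrite gt_eqF.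
      move=> h; rewrite {1}t2 ler_wpM2l ?mulr_ge0// (le_trans _ h)//.
      by rewrite lerDr.
  rewrite ge0_integralZl//; last by rewrite lee_fin mulr_ge0.
  by rewrite integral_exponential_pdf ?invr_gt0// mule1 ltry.
- exact: measurable_funTS mf.
- by move=> t _; exact: f0.
- apply/disj_setPS => t [] /=; rewrite !in_itv/= andbT => /andP[_ t1] t2.
  by move: (lt_le_trans t2 t1); rewrite ltxx.
Qed.

(** [Gamma] is the real part [fine] of an extended integral, and [fine] sends [+oo] to 0, so
    positivity depends on finiteness. On [[1, 2]] the integrand is at least [expR (- 2) / 2]. *)
Lemma Gamma_gt0 (x : R) : (2^-1 <= x)%R -> (0 < Gamma x)%R.
Proof.
move=> x2; rewrite /Gamma /Rintegral fine_gt0// gamma_integral_fin// andbT.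
apply: (@lt_le_trans _ _ (\int[mu]_(t in `[1%R, 2%R]) (2^-1 * expR (- 2))%:E)).
  rewrite integral_cst//= lebesgue_measure_itv/= lte_fin ltr1n.
  by rewrite -EFinB -EFinM lte_fin !mulr_gt0 ?expR_gt0//; lra.
have mf : measurable_fun setT (fun t : R => (t `^ (x - 1) * expR (- t))%:E).
  by apply/measurable_EFinP; exact: measurable_gamma_integrand.
have f0 t : 0 <= (t `^ (x - 1) * expR (- t))%:E.
  by rewrite lee_fin mulr_ge0 ?powR_ge0// expR_ge0.
apply: (@le_trans _ _ (\int[mu]_(t in `[1%R, 2%R]) (t `^ (x - 1) * expR (- t))%:E)).
  apply: ge0_le_integral => //=.
  - exact: measurable_funTS mf.
  - move=> t; rewrite in_itv/= => /andP[t1 t2]; rewrite lee_fin.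
    have t0 : (0 < t)%R := lt_le_trans ltr01 t1.
    apply: ler_pM; [by rewrite invr_ge0|exact: expR_ge0| |].
      apply: (@le_trans _ _ (t `^ (-1))%R); last by rewrite ler_powR//; lra.
      by rewrite powR_inv1 ?(ltW t0)// lef_pV2 ?posrE.
    by rewrite ler_expR lerN2.
apply: ge0_subset_integral => //=; first exact: measurable_funTS mf.
move=> t; rewrite /= !in_itv/= => /andP[t1 _].
by rewrite andbT (lt_le_trans ltr01).
Qed.

End gamma.

Lemma closed_convex_halfspace {R : realType} d (y : 'rV[R]_d) :
  closed [set x | dotv x y <= 1] /\ convex_set [set x : 'rV[R]_d | dotv x y <= 1].
Proof.
split.
  have -> : [set x | dotv x y <= 1] = (fun x => dotv x y) @^-1` `]-oo, 1]%classic.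
    by apply/seteqP; split => z /=; rewrite in_itv/=.
  apply: closed_comp; last exact: interval_closed.
  by move=> z _; exact: continuous_dotvl.
move=> a b p; rewrite !inE/= => a1 b1.
change (dotv (p%:inum *: (a : 'rV[R]_d) + (1 - p%:inum) *: (b : 'rV[R]_d)) y <= 1).
rewrite dotvDl !dotvZl.
have p0 : 0 <= p%:inum by [].
have p1 : p%:inum <= 1 by [].
move: p%:inum (dotv _ _) (dotv _ _) p0 p1 a1 b1 => q s t; nra.
Qed.

Lemma convex_dual_bigcap {R : realType} d (S : set 'rV[R]_d) :
  convex_dual S = \bigcap_(y in S) [set x | dotv x y <= 1].
Proof. by apply/seteqP; split => x xS y /xS. Qed.

Lemma closed_convex_dual {R : realType} d (S : set 'rV[R]_d) :
  closed (convex_dual S) /\ convex_set (convex_dual S).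
Proof.
split.
  rewrite convex_dual_bigcap; apply: closed_bigI => y _.
  exact: (closed_convex_halfspace y).1.
move=> a b p; rewrite !inE => aS bS y Sy.
have := (closed_convex_halfspace y).2 a b p.
by rewrite !inE; apply; [exact: aS|exact: bS].
Qed.

(** For fixed [x], the condition on [y] defines a closed half-space or the whole space, so it passes
    from [S] to its closed convex hull. *)
Lemma convex_dual_hull {R : realType} d (S : set 'rV[R]_d) :
  convex_dual (closed_convex_hull S) = convex_dual S.
Proof.
apply/seteqP; split => x xS y Sy.
  by apply: xS; exact: sub_gen_smallest.
have : closed_convex_hull S `<=` [set y | dotv y x <= 1].
  apply: smallest_sub; first exact: closed_convex_halfspace.
  by move=> z Sz /=; rewrite dotvC; exact: xS.
by move/(_ y Sy) => /=; rewrite dotvC.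
Qed.

Lemma eq_measure_ae {R : realType} dT (T : measurableType dT)
    (P : {measure set T -> \bar R}) (A B : set T) :
  measurable A -> measurable B -> {ae P, forall w, A w <-> B w} -> P A = P B.
Proof.
move=> mA mB [Z [mZ PZ AB]].
have sub (C D : set T) : measurable C -> measurable D ->
    (forall w, ~ Z w -> C w -> D w) -> (P C <= P D)%E.
  move=> mC mD CD; rewrite -[leRHS](measureU0 mD mZ PZ).
  apply: le_measure; rewrite ?inE//; first exact: measurableU.
  by move=> w Cw; have [|Zw] := pselect (Z w); [right|left; exact: CD].
apply/eqP; rewrite eq_le !sub// => w Zw; have ABw : A w <-> B w.
- by apply: contrapT => h; apply: Zw; exact: AB.
- exact/ABw.2.
- by apply: contrapT => h; apply: Zw; exact: AB.
- exact/ABw.1.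
Qed.

(** * Comparison of the two laws *)

Section main.
Context {R : realType} (n : nat).
Notation d := n.+1.

Lemma ctilde_neq0 : ctilde d (d%:R : R) != 0.
Proof.
rewrite /ctilde gt_eqF// divr_gt0 ?mulr_gt0 ?powR_gt0 ?pi_gt0// Gamma_gt0//.
  have : 1 <= d%:R :> R by rewrite ler1n.
  lra.
have : 1 <= d%:R :> R by rewrite ler1n.
lra.
Qed.

Local Open Scope ereal_scope.

(** [ctilde] cancels against the choice of [alpha], leaving [lambda * star_density]. The right side
    is the intensity of the nuclei whose star point falls in [A], so the void probabilities of both
    processes take the same form. *)
Lemma beta_star_intensityE (lambda : R) (A : set 'rV[R]_d) : (0 < lambda)%R ->
  measurable A ->
  beta_star_intensity (2 ^+ d * lambda / ctilde d d%:R) d%:R A =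
  lambda%:E * hyp_volume
    [set z : 'rV[R]_d.+1 | spatial z != 0%R /\ A (star_map (spatial z))].
Proof.
move=> l0 mA.
rewrite -[X in hyp_volume X]/(@spatial R d @^-1`
  ([set v | v != 0%R] `&` @star_map R d @^-1` A)).
rewrite spatial_hyp_volume change_of_variables_star_map// /beta_star_intensity.
have mAo : measurable (A `&` @outside_ball R d).
  by apply: measurableI => //; exact: measurable_outside_ball.
rewrite -ge0_integralZl//; last 3 first.
- apply/measurable_EFinP; apply: measurable_funTS; apply: measurable_fun_divr => //.
  apply: measurable_funX; apply: measurable_funB => //.
  by apply: measurable_funX; exact: measurable_enorm.
- by move=> y [_ y1]; rewrite lee_fin star_density_ge0.
- by rewrite lee_fin ltW.
apply: eq_integral => y; rewrite inE => -[_ y1]; rewrite -EFinM; congr EFin.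
have y2 : (0 < enorm y ^+ 2 - 1)%R.
  by rewrite subr_gt0 exprn_egt1.
rewrite divfK ?ctilde_neq0// powRN powR_mulrn ?(ltW y2)// /star_density.
by rewrite mulrA (mulrC lambda).
Qed.

Variables (lambda : R).
Hypothesis lambda0 : (0 < lambda)%R.
Context dT (T : measurableType dT) (P : probability T R)
  (eta : R.-ker T ~> 'rV[R]_d.+1).
Hypothesis heta : poisson_process P (hyperboloid d)
  (fun B => (lambda%:E * hyp_volume B)%E) eta.

Let N w : @missType R d := star_atoms (atoms eta w).

Let B (A : set 'rV[R]_d) : set 'rV[R]_d.+1 :=
  [set z | spatial z != 0%R /\ A (star_map (spatial z))].

Let mB A : measurable A -> measurable (B A).
Proof.
move=> mA; rewrite -[B A]/(@spatial R d @^-1`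
  ([set v | v != 0%R] `&` @star_map R d @^-1` A)).
apply: measurable_spatial_preimage; apply: measurableI; first exact: measurable_neq0_rV.
by rewrite -[X in measurable X]setTI; exact: measurable_star_map.
Qed.

Let missN A : measurable A ->
  [set w | N w `&` A = set0] = [set w | eta w (B A) = 0].
Proof.
move=> mA; have [hp _ _ _] := heta; apply/seteqP; split => w /=.
  move=> h; apply/(point_process_eq0 hp w (mB mA)); rewrite -subset0 => z [az [z0 Az]].
  have : (N w `&` A) (star_map (spatial z)) by split => //; exists z.
  by rewrite h.
move/(point_process_eq0 hp w (mB mA)) => h; rewrite -subset0 => _ [[z [az /= z0] <-] Az].
have : (atoms eta w `&` B A) z by [].
by rewrite h.
Qed.

Let mN : measurable_fun setT N.
Proof.
apply: measurable_missType => A mA; rewrite missN//.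
by apply: measurable_kernel_eq; exact: mB.
Qed.

Let voidN A : measurable A -> P [set w | N w `&` A = set0] =
  void_probability (lambda%:E * hyp_volume (B A)).
Proof.
move=> mA; rewrite missN//; apply: (poisson_process_void heta); first exact: mB.
rewrite mule_ge0 ?lee_fin ?(ltW lambda0)// hyp_volumeE; apply: integral_ge0 => v _.
by rewrite lee_fin hyp_density_ge0.
Qed.

Context dT' (T' : measurableType dT') (P' : probability T' R)
  (zeta : R.-ker T' ~> 'rV[R]_d).
Hypothesis hzeta : beta_star_process P' (2 ^+ d * lambda / ctilde d d%:R) d%:R zeta.

Let N' w : @missType R d := atoms zeta w.

Let missN' A : measurable A ->
  [set w | N' w `&` A = set0] = [set w | zeta w A = 0].
Proof.
move=> mA; have [hp _ _ _] := hzeta.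
by apply/seteqP; split => w /= h; exact/(point_process_eq0 hp w mA).
Qed.

Let mN' : measurable_fun setT N'.
Proof.
by apply: measurable_missType => A mA; rewrite missN'//; exact: measurable_kernel_eq.
Qed.

Let voidN' A : measurable A -> P' [set w | N' w `&` A = set0] =
  void_probability (lambda%:E * hyp_volume (B A)).
Proof.
move=> mA; rewrite missN'// -beta_star_intensityE//.
apply: (poisson_process_void hzeta) => //.
rewrite beta_star_intensityE// mule_ge0 ?lee_fin ?(ltW lambda0)// hyp_volumeE.
by apply: integral_ge0 => v _; rewrite lee_fin hyp_density_ge0.
Qed.

Let dual_bounded : {ae P, forall w, convex_dual (N w) `<=` @open_unit_ball R d}.
Proof.
apply: (ae_dual_bounded heta); first exact: ltW.
move=> e e0; case: n => [|m]; first exact: horoball_cover1.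
exact: horoball_cover_ge2.
Qed.

Let X w := gnomonic @` typical_cell (atoms eta w).
Let X' w := convex_dual (beta_star_polytope zeta w).

Let XE w : X w = @open_unit_ball R d `&` convex_dual (N w).
Proof.
have [hp _ _ _] := heta; apply: gnomonic_typical_cell; exact: (atoms_subset hp).
Qed.

Let X'E w : X' w = convex_dual (N' w). Proof. exact: convex_dual_hull. Qed.

Let mX H : fell_measurable H -> measurable (X @^-1` H).
Proof.
move=> FH; rewrite (_ : _ @^-1` _ = N @^-1`
    ((fun S => @open_unit_ball R d `&` convex_dual S) @^-1` H)).
  rewrite -[X in measurable X]setTI; apply: mN => //.
  by apply: measurable_fell_preimage => // K; exact: measurable_ball_dual_hit.
by apply/seteqP; split => w /=; rewrite XE.
Qed.

Let mdual H : fell_measurable H ->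
  measurable (@convex_dual R d @^-1` H : set (@missType R d)).
Proof.
by move=> FH; apply: measurable_fell_preimage => // K; exact: measurable_dual_hit.
Qed.

Let mX' H : fell_measurable H -> measurable (X' @^-1` H).
Proof.
move=> FH; rewrite (_ : _ @^-1` _ = N' @^-1` (@convex_dual R d @^-1` H)).
  by rewrite -[X in measurable X]setTI; apply: mN' => //; exact: mdual.
by apply/seteqP; split => w /=; rewrite X'E.
Qed.

Lemma same_distribution_cell_polytope : same_distribution P X P' X'.
Proof.
have XN : {ae P, forall w, X w = convex_dual (N w)}.
  apply: filterS dual_bounded => w h; rewrite XE; exact/setIidr.
split.
- split; first exact: mX.
  apply: filterS XN => w ->; exact: closed_convex_dual.
- split; first exact: mX'.
  by apply: aeW => w; rewrite X'E; exact: closed_convex_dual.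
- move=> H FH.
  (* The ball is dropped almost surely; afterwards both sides are the same measurable function of
     random sets with equal laws on [missType]. *)
  transitivity (P (N @^-1` (@convex_dual R d @^-1` H))).
    apply: eq_measure_ae; first exact: mX.
      rewrite -[X in measurable X]setTI; apply: mN => //; exact: mdual.
    by apply: filterS XN => w; rewrite /preimage/= => ->.
  rewrite (@eq_law_missType R d _ _ P N _ _ P' N')//; last first.
  - exact: mdual.
  - by move=> A mA; rewrite voidN// voidN'.
  by congr (P' _); apply/seteqP; split => w /=; rewrite X'E.
Qed.

End main.

Theorem theorem3p10 (R : realType) (d : nat) (hd : (0 < d)%N)
    (lambda : R) (hlambda : 0 < lambda)
    (dT : measure_display) (T : measurableType dT) (P : probability T R)
    (eta : R.-ker T ~> 'rV[R]_d.+1)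
    (heta : poisson_process P (hyperboloid d)
              (fun B => (lambda%:E * hyp_volume B)%E) eta)
    (alpha : R) (halpha : alpha = 2 ^+ d * lambda / ctilde d d%:R)
    (dT' : measure_display) (T' : measurableType dT') (P' : probability T' R)
    (zeta : R.-ker T' ~> 'rV[R]_d)
    (hzeta : beta_star_process P' alpha d%:R zeta) :
  alpha = 2 ^+ d * pi `^ (d%:R / 2) * lambda * Gamma (d%:R / 2) / Gamma d%:R /\
  same_distribution
    P (fun w => gnomonic @` typical_cell (atoms eta w))
    P' (fun w => convex_dual (beta_star_polytope zeta w)).
Proof.
split.
  rewrite halpha /ctilde invf_div.
  have -> : d%:R - d%:R / 2 = d%:R / 2 :> R by lra.
  by rewrite !mulrA; congr (_ / _); rewrite -!mulrA; congr (_ * _); rewrite mulrCA.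
case: d hd eta heta halpha zeta hzeta => [//|n] _ eta heta halpha zeta hzeta.
rewrite halpha in hzeta; exact: (same_distribution_cell_polytope hlambda heta hzeta).
Qed.
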